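(* Let $A=(A^1,\dots,A^d)$ be a normal tensor (each $A^i$ a $D\times D$ complex matrix) with finite correlation length $\xi>0$, and for each $N$ let $$|\phi_N\rangle=\frac{1}{c_N}\sum_{i_1,\dots,i_N=1}^d \mathrm{Tr}\left(A^{i_1}\cdots A^{i_N}\right)|i_1\cdots i_N\rangle$$ be the corresponding normalized translation-invariant matrix product state on $N$ sites ($c_N>0$ a normalization constant). For each $N$ let $|\psi_N\rangle$ be a state of the same $N$ sites obtained by applying a depth-$T$ local quantum circuit to a product state, where $T=T(N)$, and let $\epsilon=\epsilon(N)=1-|\langle\phi_N|\psi_N\rangle|$. If $T=o(\log N)$, then there is some $N_0$ such that for all $N>N_0$ we have $\epsilon>1/2$.
   Context: A tensor $A$ is normal if (i) the matrices $A^1,\dots,A^d$ have no nontrivial common invariant subspace, and (ii) its transfer matrix $E_A=\sum_{i=1}^d (A^i)^*\otimes A^i$ has a unique eigenvalue of largest magnitude, normalized to $\lambda_1=1$, and no other eigenvalue of the same magnitude. The correlation length is $\xi=-1/\ln|\lambda_2|$, where $\lambda_2$ is the subleading eigenvalue (second largest in magnitude) of $E_A$. A depth-$T$ local quantum circuit on a one-dimensional chain of sites consists of $T$ layers, each layer a product of unitary gates acting on disjoint sets of neighboring sites of bounded size. *)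

(* Defs.v *)
From HB Require Import structures.
From mathcomp Require Import all_boot all_order all_algebra.
From mathcomp Require Import complex mxtens.
From mathcomp Require Import reals exp.
Set Implicit Arguments.
Unset Strict Implicit.
Unset Printing Implicit Defensive.
Import Order.TTheory GRing.Theory Num.Theory.
Local Open Scope ring_scope.

Section Defs.
Variable R : realType.
Local Notation C := (R[i]).

Definition cabs (z : C) : R := Num.sqrt (complex.Re z ^+ 2 + complex.Im z ^+ 2).

Definition transfer (d D : nat) (A : 'I_d -> 'M[C]_D) : 'M[C]_(D * D) :=
  \sum_(i < d) (map_mx (@conjc R) (A i) *t A i).

(* (i) no nontrivial common invariant subspace: every subspace V of C^D
   (given as the row space of a matrix whose rows, viewed as column vectors,
   span V) with A^i V <= V for all i is {0} or C^D. *)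
Definition irreducible_tensor (d D : nat) (A : 'I_d -> 'M[C]_D) : Prop :=
  forall V : 'M[C]_D, (forall i, stablemx V (A i)^T) ->
    (\rank V = 0)%N \/ row_full V.

Definition peripheral_gap (d D : nat) (A : 'I_d -> 'M[C]_D) : Prop :=
  root (char_poly (transfer A)) 1 /\
  forall mu, root (char_poly (transfer A)) mu -> mu != 1 -> cabs mu < 1.

Definition normal_tensor (d D : nat) (A : 'I_d -> 'M[C]_D) : Prop :=
  irreducible_tensor A /\ peripheral_gap A.

(* lambda2 is a subleading eigenvalue: an eigenvalue of largest modulus in the
   spectrum (with algebraic multiplicity) of E_A with one copy of the leading
   eigenvalue 1 removed. *)
Definition subleading (d D : nat) (A : 'I_d -> 'M[C]_D) (l2 : C) : Prop :=
  let q := char_poly (transfer A) %/ ('X - 1%:P) in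
  root q l2 /\ forall mu, root q mu -> cabs mu <= cabs l2.

Definition corr_length (d D : nat) (A : 'I_d -> 'M[C]_D) (xi : R) : Prop :=
  exists l2, subleading A l2 /\ xi = - (ln (cabs l2))^-1.

Definition config (N d : nat) := {ffun 'I_N -> 'I_d}.
Definition state (N d : nat) := config N d -> C.

Definition dot (N d : nat) (u v : state N d) : C :=
  \sum_(x : config N d) conjc (u x) * v x.

Definition snorm (N d : nat) (v : state N d) : R :=
  Num.sqrt (\sum_(x : config N d) cabs (v x) ^+ 2).

Definition mps_raw (d D : nat) (A : 'I_d -> 'M[C]_D) (N : nat) : state N d :=
  fun x => \tr (\big[mulmx/1%:M]_(j < N) A (x j)).

Definition mps (d D : nat) (A : 'I_d -> 'M[C]_D) (N : nat) : state N d :=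
  fun x => @mps_raw d D A N x / Complex (snorm (@mps_raw d D A N)) 0.

Definition op (N d : nat) := config N d -> config N d -> C.

Definition apply_op (N d : nat) (G : op N d) (v : state N d) : state N d :=
  fun x => \sum_(y : config N d) G x y * v y.

Definition unitary_op (N d : nat) (G : op N d) : Prop :=
  forall y y' : config N d,
    \sum_(x : config N d) conjc (G x y) * G x y' = (y == y')%:R.

Definition agree_on (N d : nat) (S : {set 'I_N}) (x y : config N d) : bool :=
  [forall i in S, x i == y i].
Definition agree_off (N d : nat) (S : {set 'I_N}) (x y : config N d) : bool :=
  [forall i in ~: S, x i == y i].

(* G = g (x) Id, with g acting on the sites of S only *)
Definition acts_on (N d : nat) (S : {set 'I_N}) (G : op N d) : Prop :=
  (forall x y, ~~ agree_off S x y -> G x y = 0) /\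
  (forall x y x' y', agree_on S x x' -> agree_on S y y' ->
     agree_off S x y -> agree_off S x' y' -> G x y = G x' y').

(* a block of at most k consecutive sites of the chain (periodic) *)
Definition block (N k : nat) (S : {set 'I_N}) : Prop :=
  exists (a : 'I_N) (m : nat), (m <= k)%N /\
    S = [set i : 'I_N | ((i + N - a) %% N < m)%N].

Definition is_layer (N d k : nat) (L : op N d) : Prop :=
  exists (n : nat) (S : 'I_n -> {set 'I_N}) (G : 'I_n -> op N d),
    (forall j, block k (S j)) /\
    (forall j, acts_on (S j) (G j)) /\
    (forall j, unitary_op (G j)) /\
    (forall j j', j != j' -> [disjoint S j & S j']) /\
    (forall v, apply_op L v = foldr (fun j w => apply_op (G j) w) v (enum 'I_n)).

Definition product_state (N d : nat) (p : state N d) : Prop :=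
  exists u : 'I_N -> 'I_d -> C,
    (forall j, \sum_(a < d) cabs (u j a) ^+ 2 = 1) /\
    forall x, p x = \prod_(j < N) u j (x j).

Definition circuit_state (N d k T : nat) (psi : state N d) : Prop :=
  exists (Ls : 'I_T -> op N d) (p : state N d),
    (forall t, is_layer k (Ls t)) /\ product_state p /\
    psi = foldl (fun v t => apply_op (Ls t) v) p (enum 'I_T).

Definition little_o_log (T : nat -> nat) : Prop :=
  forall eps : R, 0 < eps ->
    exists M : nat, forall N : nat, (M < N)%N -> (T N)%:R <= eps * ln (N%:R : R).

End Defs.
Arguments mps_raw {R d D} A N _.
Arguments mps {R d D} A N _.

(* Main.v *)
(** A depth-[T] circuit with gates on [k] consecutive sites produces states whose
    correlations vanish exactly beyond distance [2 k T].  In the matrix product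
    state, correlations at distance [r] are of order [|lam|^r], where [lam] is the
    subleading eigenvalue of the transfer matrix [E], and [T = o(log N)] makes this
    decay slower than any power of [1/N].

    Normality makes the words [A^{i_1} ... A^{i_l}] of some fixed length [l] span
    all matrices: the Gram matrix of the words of length [m] is a reshuffling of
    [E^m], whose limit is the tensor product of the left and right fixed points of
    [E], and these are definite by irreducibility.  So every [D^2 x D^2] matrix is
    the transfer matrix of an operator on [l] sites, and one can choose [X] and [Y]
    with transfer matrices [u w] and [z v0], where [u], [v0] are the fixed points,
    [w] is a left eigenvector for [lam] and [z] is dual to it.  Then, exactly,
    [<X> = 0] and [<X Y> = lam^r / tr E^N] in the matrix product state.

    Take [n] well separated blocks.  On each of them [X] or [X Y] has means in the
    two states that differ by at least [c |lam|^r], while the sum of these operators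
    has fluctuations of order [sqrt n] in both states.  Comparing the two values of
    [<psi| sum |phi>] bounds the overlap by a multiple of [1 / (|lam|^r sqrt n)],
    up to small terms. *)
Require Import Defs.
From HB Require Import structures.
From mathcomp Require Import all_boot all_order all_algebra.
From mathcomp Require Import complex mxtens.
From mathcomp Require Import reals sequences exp.
From mathcomp Require Import lra ring zify.
Import Order.TTheory GRing.Theory Num.Theory.
Local Open Scope ring_scope.

Set Implicit Arguments.
Unset Strict Implicit.
Unset Printing Implicit Defensive.

(** * Powers of a matrix with a spectral gap *)

Section ComplexModulus.
Variable R : realType.
Local Notation C := R[i].
Implicit Types z w : C.

Lemma cabsE z : cabs z = ComplexField.Normc.normc z.
Proof. by case: z. Qed.

Lemma normCE z : `|z| = (cabs z)%:C%C.
Proof. by rewrite cabsE; case: z. Qed.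

Lemma cabs_ge0 z : 0 <= cabs z.
Proof. exact: sqrtr_ge0. Qed.

Lemma cabs0 : cabs (0 : C) = 0.
Proof. by rewrite cabsE ComplexField.Normc.normc0. Qed.

Lemma cabs1 : cabs (1 : C) = 1.
Proof. by rewrite cabsE ComplexField.Normc.normc1. Qed.

Lemma cabs_eq0 z : (cabs z == 0) = (z == 0).
Proof.
apply/eqP/eqP => [|->]; last exact: cabs0.
by rewrite cabsE; apply: ComplexField.Normc.eq0_normc.
Qed.

Lemma cabs_gt0 z : (0 < cabs z) = (z != 0).
Proof. by rewrite lt_def cabs_ge0 andbT cabs_eq0. Qed.

Lemma cabsM z w : cabs (z * w) = cabs z * cabs w.
Proof. by rewrite !cabsE ComplexField.Normc.normcM. Qed.

Lemma cabsV z : cabs z^-1 = (cabs z)^-1.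
Proof. by rewrite !cabsE ComplexField.Normc.normcV. Qed.

Lemma cabsN z : cabs (- z) = cabs z.
Proof. by rewrite !cabsE normcN. Qed.

Lemma cabsD z w : cabs (z + w) <= cabs z + cabs w.
Proof. by rewrite !cabsE le_normcD. Qed.

Lemma cabsB z w : cabs (z - w) <= cabs z + cabs w.
Proof. by rewrite -(cabsN w) cabsD. Qed.

Lemma cabsX z n : cabs (z ^+ n) = cabs z ^+ n.
Proof. by elim: n => [|n IH]; rewrite ?cabs1 // !exprS cabsM IH. Qed.

Lemma cabsJ z : cabs (conjc z) = cabs z.
Proof. by case: z => a b; rewrite /cabs /= sqrrN. Qed.

Lemma cabs_sum I (r : seq I) (P : pred I) (F : I -> C) :
  cabs (\sum_(i <- r | P i) F i) <= \sum_(i <- r | P i) cabs (F i).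
Proof.
elim/big_rec2: _ => [|i y x _ le_xy]; first by rewrite cabs0.
by apply: le_trans (cabsD _ _) _; rewrite lerD2l.
Qed.

Lemma cabs_real (x : R) : cabs x%:C%C = `|x|.
Proof. by rewrite /cabs /= expr0n addr0 sqrtr_sqr. Qed.

Lemma mulJc z : conjc z * z = (cabs z ^+ 2)%:C%C.
Proof.
by rewrite mulrC -sqr_normc normCE -rmorphXn.
Qed.

Lemma Re_le_cabs z : complex.Re z <= cabs z.
Proof.
case: z => a b; rewrite /cabs /=; apply: le_trans (ler_norm _) _.
by rewrite -sqrtr_sqr ler_wsqrtr // lerDl sqr_ge0.
Qed.

Lemma phase_ex z : exists2 u : C, cabs u = 1 & u * z = (cabs z)%:C%C.
Proof.
have [->|z0] := eqVneq z 0; first by exists 1; rewrite ?cabs1 // mulr0 cabs0.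
exists (conjc z / (cabs z)%:C%C).
  by rewrite cabsM cabsJ cabsV cabs_real ger0_norm ?cabs_ge0 // divff ?cabs_eq0.
have nz : (cabs z)%:C%C != 0 :> C by rewrite eq_complex /= negb_and cabs_eq0 z0.
by rewrite mulrAC mulJc rmorphXn /= expr2 mulfK.
Qed.

End ComplexModulus.

Section PowerDecay.
Variable R : realType.
Local Notation C := R[i].

(** With [c = K / (rho - |mu|)] one has [|mu| c + K = c rho], so the bound reproduces itself at each
    step; the term in [|y 0|] only gains from [|mu| < rho]. *)
Lemma linear_recurrence_bound (y z : nat -> C) (mu : C) (rho K : R) :
    cabs mu < rho -> (forall m, y m.+1 = mu * y m + z m) ->
    (forall m, cabs (z m) <= K * rho ^+ m) ->
  forall m, cabs (y m) <= (cabs (y 0%N) + K / (rho - cabs mu)) * rho ^+ m.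
Proof.
move=> mu_rho yS zK; have rho0 : 0 < rho - cabs mu by rewrite subr_gt0.
have K0 : 0 <= K by have := zK 0%N; rewrite expr0 mulr1; apply: le_trans; exact: cabs_ge0.
have r0 : 0 <= rho by apply: le_trans (ltW mu_rho); exact: cabs_ge0.
set c := K / _; have c0 : 0 <= c by rewrite divr_ge0 // ltW.
have Kc : K = c * (rho - cabs mu) by rewrite divfK // gt_eqF.
elim=> [|m IH]; first by rewrite expr0 mulr1 lerDl.
rewrite yS; apply: le_trans (cabsD _ _) _; rewrite cabsM.
apply: le_trans (lerD (ler_wpM2l (cabs_ge0 _) IH) (zK m)) _.
rewrite exprS Kc; have := cabs_ge0 (y 0%N); have := exprn_ge0 m r0.
set q := rho ^+ m; set y0 := cabs (y 0%N); set s := cabs mu in mu_rho * => q0 y00.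
have -> : (y0 + c) * (rho * q) = s * ((y0 + c) * q) + c * (rho - s) * q + y0 * ((rho - s) * q) by ring.
by rewrite lerDl mulr_ge0 // mulr_ge0 // subr_ge0 ltW.
Qed.

(** The head factor multiplies [B] first, so that an induction on the list changes only [B]. *)
Fixpoint mxfactors n (E : 'M[C]_n) (rs : seq C) (B : 'M[C]_n) : 'M[C]_n :=
  if rs is r :: rs' then mxfactors E rs' ((E - r%:M) *m B) else B.

(** This stands in for the Jordan form: the entries of [E ^+ m *m B] obey a first-order recurrence
    with ratio [r], whose source term is the same quantity for [(E - r) B]. *)
Lemma mxfactors_decay n (E : 'M[C]_n) (rho : R) (rs : seq C) (B : 'M[C]_n) :
    0 < rho -> (forall r, r \in rs -> cabs r < rho) -> mxfactors E rs B = 0 ->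
  exists2 K, 0 <= K & forall m i j, cabs ((E ^+ m *m B) i j) <= K * rho ^+ m.
Proof.
move=> rho0; elim: rs B => [|r rs IH] B /= hrs.
  by move=> ->; exists 0 => // m i j; rewrite mulmx0 mxE cabs0 mul0r.
move/IH => [r' r'rs|K K0 hK]; first by apply: hrs; rewrite inE r'rs orbT.
have r_rho : cabs r < rho by apply: hrs; rewrite inE eqxx.
have r0 : 0 < rho - cabs r by rewrite subr_gt0.
exists (\sum_i \sum_j cabs (B i j) + K / (rho - cabs r)).
  rewrite addr_ge0 ?divr_ge0 ?(ltW r0) //.
  by apply: sumr_ge0 => i _; apply: sumr_ge0 => j _; exact: cabs_ge0.
move=> m i j.
have := @linear_recurrence_bound (fun m => (E ^+ m *m B) i j)
  (fun m => (E ^+ m *m ((E - r%:M) *m B)) i j) r rho K r_rho.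
rewrite expr0 mul1mx => /(_ _ (fun m => hK m i j)) h.
apply: le_trans (h _ m) _.
  move=> m'; have -> : E ^+ m'.+1 *m B = r *: (E ^+ m' *m B) + E ^+ m' *m ((E - r%:M) *m B).
    by rewrite mulmxBl mulmxBr mul_scalar_mx -scalemxAr addrC subrK mulmxA exprSr.
  by rewrite mxE [X in X + _]mxE.
rewrite ler_wpM2r ?exprn_ge0 ?(ltW rho0) // ?lerD2r.
rewrite (bigD1 i) //= (bigD1 j) //= -addrA lerDl addr_ge0 //.
  by apply: sumr_ge0 => k _; exact: cabs_ge0.
by apply: sumr_ge0 => k _; apply: sumr_ge0 => l _; exact: cabs_ge0.
Qed.

Lemma mxfactors_horner n (E : 'M[C]_n.+1) (rs : seq C) (B : 'M[C]_n.+1) :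
  mxfactors E rs B = horner_mx E (\prod_(r <- rs) ('X - r%:P)) *m B.
Proof.
elim: rs B => [|r rs IH] B /=; first by rewrite big_nil rmorph1 mul1mx.
by rewrite IH big_cons mulrC rmorphM /= rmorphB /= horner_mx_X horner_mx_C mulmxA.
Qed.

End PowerDecay.

(** Write [P] as [col_base P *m row_base P] and cancel the outer factors in [P P = P]. *)
Lemma row_base_col_base (F : fieldType) n (P : 'M[F]_n) : P *m P = P -> row_base P *m col_base P = 1%:M.
Proof.
rewrite -{1 2 3}(mulmx_base P) mulmxA => /(congr1 (fun M => M *m pinvmx (row_base P))).
rewrite !mulmxKp ?row_base_free // -mulmxA -[RHS]mulmx1 => /row_full_inj-> //.
exact: col_base_full.
Qed.

(** * The rank-one spectral projection at the eigenvalue 1 *)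

Section SpectralProjection.
Variable R : realType.
Local Notation C := R[i].

Lemma trig_mulmx n (S T : 'M[C]_n) : is_trig_mx S -> is_trig_mx T ->
  is_trig_mx (S *m T) /\ forall i, (S *m T) i i = S i i * T i i.
Proof.
move=> /is_trig_mxP hS /is_trig_mxP hT; split.
  apply/is_trig_mxP => i j ij; rewrite mxE big1 // => k _.
  have [ik|ki] := ltnP i k; first by rewrite hS ?mul0r.
  by rewrite hT ?mulr0 // (leq_ltn_trans ki).
move=> i; rewrite mxE (bigD1 i) //= big1 ?addr0 // => k ki.
have [ik|] := ltnP i k; first by rewrite hS ?mul0r.
by rewrite leq_eqVlt (inj_eq val_inj) (negPf ki) /= => lt_ki; rewrite hT ?mulr0.
Qed.

Lemma horner_mx_trig n (T : 'M[C]_n.+1) (p : {poly C}) : is_trig_mx T ->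
  is_trig_mx (horner_mx T p) /\ forall i, (horner_mx T p) i i = p.[T i i].
Proof.
move=> hT; elim/poly_ind: p => [|p c [IHt IHd]].
  by rewrite rmorph0; split => [|i]; rewrite ?mx0_is_trig ?mxE ?horner0.
have [t1 d1] := trig_mulmx IHt hT.
have hE : horner_mx T (p * 'X + c%:P) = horner_mx T p *m T + c%:M.
  by rewrite rmorphD rmorphM /= horner_mx_X horner_mx_C.
split => [|i]; last by rewrite hE mxE d1 IHd !hornerE mxE eqxx mulr1n.
apply/is_trig_mxP => i j ij; rewrite hE mxE (is_trig_mxP t1 _ _ ij) add0r mxE.
by rewrite -(inj_eq val_inj) ltn_eqF.
Qed.

Lemma char_poly_conj n (U V E : 'M[C]_n) : U *m V = 1%:M ->
  char_poly (U *m E *m V) = char_poly E.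
Proof.
move=> UV; have pUV : map_mx polyC U *m map_mx polyC V = 1%:M by rewrite -map_mxM UV map_mx1.
have : char_poly_mx (U *m E *m V) = map_mx polyC U *m char_poly_mx E *m map_mx polyC V.
  rewrite /char_poly_mx mulmxBr mulmxBl -!map_mxM mul_mx_scalar -scalemxAl pUV.
  by rewrite scalemx1.
rewrite /char_poly => ->; rewrite !det_mulmx mulrAC -det_mulmx pUV det1 mul1r.
by [].
Qed.

(** A unitary triangularization puts the eigenvalues on the diagonal, where a polynomial acts
    entrywise. *)
Lemma mxtrace_horner_mx n (E : 'M[C]_n.+1) (p : {poly C}) :
  exists2 t : seq C, char_poly E = \prod_(r <- t) ('X - r%:P) &
    \tr (horner_mx E p) = \sum_(r <- t) p.[r].
Proof.
have [U Uu trU] := Schur E (ltn0Sn n).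
have Uunit : U \in unitmx by exact: unitarymx_unit.
have Ec : conjmx U E = U *m E *m invmx U by rewrite conjumx.
exists [seq (conjmx U E) i i | i <- enum 'I_n.+1].
  rewrite big_map big_enum /= -char_poly_trig // Ec char_poly_conj //.
  exact: mulmxV.
rewrite big_map big_enum /=.
have [_ d] := horner_mx_trig p trU.
rewrite -(eq_bigr _ (fun i _ => d i)) -[RHS]/(\tr _) Ec horner_mx_uconj //.
by rewrite mxtrace_mulC mulmxA mulVmx // mul1mx.
Qed.

(** The projection is [p(E)] with [p = q / q(1)]. The characteristic polynomial is [(X - 1) q], so
    Cayley-Hamilton gives [(E - 1) P = 0], and [q(E)] kills [1 - P], where the powers of [E]
    therefore decay. *)
Lemma spectral_projection n (E : 'M[C]_n) (lam : C) :
    root (char_poly E) 1 ->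
    let q := char_poly E %/ ('X - 1%:P) in
    (forall mu, root q mu -> cabs mu <= cabs lam) -> cabs lam < 1 ->
  exists (u : 'cV[C]_n) (v : 'rV[C]_n),
  [/\ E *m u = u, v *m E = v, v *m u = 1%:M &
   exists K rho, [/\ 0 <= K, 0 < rho, rho < 1 &
     forall m i j, cabs ((E ^+ m - u *m v) i j) <= K * rho ^+ m]].
Proof.
case: n E => [|n] E root1 q hq lam1.
  by move: root1; rewrite /char_poly det_mx00 rootC oner_eq0.
have chiE : char_poly E = ('X - 1%:P) * q.
  by rewrite mulrC divpK // dvdp_XsubCl.
have chi_monic := char_poly_monic E.
have q_monic : q \is monic by rewrite -(monicMl _ (monicXsubC 1)) -chiE.
have [rs hrs] := closed_field_poly_normal q.
rewrite (monicP q_monic) scale1r in hrs.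
have rootq r : r \in rs -> root q r by rewrite hrs root_prod_XsubC.
have q1 : q.[1] != 0.
  apply/negP => /hq; rewrite cabs1 => /le_lt_trans/(_ lam1).
  by rewrite ltxx.
pose hE p := horner_mx E p.
have hM p1 p2 : hE (p1 * p2) = hE p1 *m hE p2 by rewrite /hE rmorphM.
have hC p1 p2 : hE p1 *m hE p2 = hE p2 *m hE p1 by rewrite -!hM mulrC.
have hX : hE 'X = E by rewrite /hE horner_mx_X.
have chi0 : hE (('X - 1%:P) * q) = 0 by rewrite -chiE /hE Cayley_Hamilton.
pose p := (q.[1])^-1 *: q.
have p1 : p.[1] = 1 by rewrite hornerZ mulVf.
pose P := hE p.
have XP0 : hE ('X - 1%:P) *m P = 0 by rewrite -hM -scalerAr /hE linearZ /= -/(hE _) chi0 scaler0.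
(* Modulo [X - 1], which kills [P], the polynomial [f] is the constant [f(1)]. *)
have fP (f : {poly C}) : hE f *m P = f.[1] *: P.
  have : root (f - f.[1]%:P) 1 by rewrite rootE !hornerE subrr.
  rewrite -dvdp_XsubCl => /divpK; set g := (_ %/ _) => fg.
  have -> : f = g * ('X - 1%:P) + f.[1]%:P by rewrite fg subrK.
  rewrite {1}/hE rmorphD /= mulmxDl -/(hE _) hM -mulmxA XP0 mulmx0 add0r.
  by rewrite horner_mx_C mul_scalar_mx !hornerE subrr mulr0 add0r.
have EP : E *m P = P by rewrite -{1}hX fP hornerX scale1r.
have PE : P *m E = P by rewrite -{1}hX hC fP hornerX scale1r.
have PP : P *m P = P by rewrite {1}/P fP p1 scale1r.
(* The trace sums [p] over the eigenvalues: 1 at the eigenvalue 1 and 0 at each root of [q]. A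
   projection of trace 1 has rank 1, so its bases are single vectors. *)
have trP : \tr P = 1.
  have [t ht ->] := mxtrace_horner_mx E p.
  have pe : perm_eq t (1 :: rs).
    by apply: prod_XsubC_eq; rewrite -ht big_cons -hrs chiE.
  rewrite (perm_big _ pe) big_cons p1 big_seq big1 /= ?addr0 // => r /rootq /eqP qr.
  by rewrite hornerZ qr mulr0.
have Pbase := row_base_col_base PP.
have rkP : \rank P = 1%N.
  apply/eqP; rewrite -(eqr_nat C) -mxtrace1 -Pbase -mxtrace_mulC mulmx_base trP.
  by [].
move: (col_base P) (row_base P) Pbase (mulmx_base P); rewrite rkP => u v vu uv.
have u_E : E *m u = u.
  by rewrite -[u in LHS]mulmx1 -vu mulmxA uv mulmxA EP -uv -mulmxA vu mulmx1.
have v_E : v *m E = v.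
  by rewrite -[v in LHS]mul1mx -vu -!mulmxA [u *m _]mulmxA uv PE -uv mulmxA vu mul1mx.
exists u, v; split => //; rewrite uv.
have EmP m : E ^+ m *m P = P.
  by elim: m => [|m IH]; rewrite ?mul1mx // exprS -mulmxA IH.
(* [X - 1] divides [1 - p], so [q (1 - p)] is a multiple of the characteristic polynomial. *)
have : root (1 - p) 1 by rewrite rootE hornerD hornerN hornerC p1 subrr.
rewrite -dvdp_XsubCl => /divpK; set g := (_ %/ _) => pg.
have fac0 : mxfactors E rs (1%:M - P) = 0.
  have -> : 1%:M - P = hE (1 - p).
    rewrite /hE rmorphB; congr (_ - _).
    by symmetry; exact: (rmorph1 (horner_mx E)).
  rewrite mxfactors_horner -hrs -/(hE q) -pg -hM.
  by rewrite mulrCA [q * _]mulrC hM chi0 mulmx0.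
(* Any number strictly between [|lam|] and 1 would do; strictness absorbs the polynomial factors due
   to repeated roots. *)
pose rho := (1 + cabs lam) / 2.
have c0 := cabs_ge0 lam.
have rho0 : 0 < rho by rewrite /rho; lra.
have rho1 : rho < 1 by rewrite /rho; lra.
have [|K K0 hK] := mxfactors_decay rho0 _ fac0.
  by move=> r /rootq /hq rl; rewrite /rho; lra.
exists K, rho; split => // m i j.
by have := hK m i j; rewrite mulmxBr mulmx1 EmP.
Qed.

End SpectralProjection.

(** * Injectivity of normal tensors *)

Section RealLimits.
Variable R : realType.
Local Notation C := R[i].

(** Bernoulli's inequality for [rho^-1 = 1 + dl]. *)
Lemma expr_small (rho K eps : R) : 0 < rho -> rho < 1 -> 0 < eps ->
  exists M : nat, forall m, (M <= m)%N -> K * rho ^+ m < eps.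
Proof.
move=> rho0 rho1 eps0.
pose dl := rho^-1 - 1.
have dl0 : 0 < dl by rewrite subr_gt0 invf_gt1.
have rd : rho * (1 + dl) = 1 by rewrite addrCA subrr addr0 divff // gt_eqF.
clearbody dl.
have bern m : rho ^+ m * (1 + m%:R * dl) <= 1.
  elim: m => [|m IH]; first by rewrite expr0 mul1r mul0r addr0.
  apply: le_trans IH; rewrite exprSr -mulrA ler_wpM2l ?exprn_ge0 ?(ltW rho0) //.
  have m0 : 0 <= m%:R :> R by rewrite ler0n.
  have : 0 <= m%:R * dl by rewrite mulr_ge0 // ltW.
  rewrite -natr1; nra.
have [M hM] : exists M : nat, `|K| / (eps * dl) < M%:R.
  by exists (Num.bound (`|K| / (eps * dl))); rewrite archi_boundP // divr_ge0 // mulr_ge0 // ltW.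
exists M => m Mm; apply: le_lt_trans (ler_wpM2r (exprn_ge0 _ (ltW rho0)) (ler_norm K)) _.
have Km : `|K| < eps * (1 + m%:R * dl).
  rewrite ltr_pdivrMr ?mulr_gt0 // in hM; apply: lt_le_trans hM _.
  rewrite mulrDr mulr1 mulrCA; apply: ler_wpDl; first exact: ltW.
  by rewrite ler_pM2l // ler_wpM2r ?ler_nat ?(ltW dl0).
have h1 : 0 < 1 + m%:R * dl by rewrite ltr_wpDr // mulr_ge0 // ltW.
apply: lt_le_trans (_ : eps * (1 + m%:R * dl) * rho ^+ m <= _).
  by rewrite ltr_pM2r // exprn_gt0.
by rewrite -mulrA ler_piMr ?(ltW eps0) // mulrC.
Qed.

(** In the order of [R[i]], nonnegative means real and nonnegative. The squared distance from [l] to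
    the half-line of such numbers is at most [(K rho ^+ m) ^+ 2] for every [m], hence zero. *)
Lemma cvg_ge0 (z : nat -> C) (l : C) (rho K : R) : 0 < rho -> rho < 1 ->
  (forall m, cabs (z m - l) <= K * rho ^+ m) -> (forall m, 0 <= z m) -> 0 <= l.
Proof.
move=> rho0 rho1 hz z0; rewrite lecE /=.
have bnd m : (complex.Im l) ^+ 2 + (Num.max 0 (- complex.Re l)) ^+ 2 <= (K * rho ^+ m) ^+ 2.
  have := hz m; rewrite -ler_sqr ?nnegrE ?cabs_ge0 //; last first.
    by apply: le_trans (hz m); exact: cabs_ge0.
  apply: le_trans.
  rewrite /cabs sqr_sqrtr ?addr_ge0 ?sqr_ge0 //.
  have := z0 m; rewrite lecE /=; case: (z m) (l) => [a b] [a' b'] /= /andP[/eqP -> a0].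
  rewrite sub0r sqrrN addrC lerD2r.
  case: (lerP 0 (- a')) => [h|h]; last by rewrite expr0n /= sqr_ge0.
  by rewrite ler_sqr ?nnegrE ?lerDr // addr_ge0.
have h0 : (complex.Im l) ^+ 2 + (Num.max 0 (- complex.Re l)) ^+ 2 <= 0.
  rewrite leNgt; apply/negP => pos.
  set q := (X in 0 < X) in pos bnd.
  (* The minimum with 1 ensures [s < 1], so that [s ^+ 2 <= s < q]. *)
  have q0 : 0 < Num.min 1 q by rewrite lt_min ltr01.
  have [M hM] := expr_small `|K| rho0 rho1 q0.
  have := hM M (leqnn M); have := bnd M.
  have K0 : 0 <= K * rho ^+ M by apply: le_trans (hz M); exact: cabs_ge0.
  have : `|K| * rho ^+ M = K * rho ^+ M.
    by rewrite -{1}(ger0_norm (exprn_ge0 M (ltW rho0))) -normrM ger0_norm.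
  move=> ->; set s := K * _ in K0 *; rewrite lt_min => qs /andP[s1 sq].
  have ss : s ^+ 2 <= s by rewrite expr2 ler_piMr // ltW.
  by have := le_lt_trans (le_trans qs ss) sq; rewrite ltxx.
have := sqr_ge0 (complex.Im l); have := sqr_ge0 (Num.max 0 (- complex.Re l)) => m0 i0.
have /eqP : (complex.Im l) ^+ 2 = 0 by lra.
rewrite sqrf_eq0 => ->.
have /eqP : (Num.max 0 (- complex.Re l)) ^+ 2 = 0 by lra.
rewrite sqrf_eq0 => /eqP mx; rewrite -oppr_le0 -mx le_max lexx orbT.
by [].
Qed.

Lemma affine_ge0_slope (e g : R) : (forall s, 0 <= s * e + g) -> e = 0.
Proof.
move=> h; apply/eqP/negPn/negP => e0.
have := h (- (g + 1) / e); rewrite divfK //; lra.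
Qed.

End RealLimits.

(** * Kernels of positive semidefinite forms *)

Section PositiveForms.
Variable R : realType.
Local Notation C := R[i].
Local Notation cj := (@conjc R).

Definition adjmx m n (B : 'M[C]_(m, n)) : 'M[C]_(n, m) := (map_mx cj B)^T.

Definition form n (H : 'M[C]_n) (x : 'rV[C]_n) : C := (x *m H *m adjmx x) 0 0.

(** Along [t x + y] a form vanishing at [x] is affine in [t], so nonnegativity forces the slope to
    vanish. The scalar [c] allows for forms that are semidefinite only up to a factor, as the fixed
    points of the transfer matrix are. *)
Lemma psd_kernel n (H : 'M[C]_n) (c : C) : c != 0 ->
  (forall x, 0 <= c * form H x) -> forall x, form H x = 0 -> x *m H = 0.
Proof.
move=> c0 psd x hx; apply/rowP => j.
pose y : 'rV[C]_n := delta_mx 0 j.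
have yE (M : 'rV[C]_n) : (M *m adjmx y) 0 0 = M 0 j.
  rewrite mxE (bigD1 j) //= big1 ?addr0 => [|k kj]; rewrite !mxE ?eqxx ?conjc1 ?mulr1 //.
  by rewrite (negPf kj) andbF conjc0 mulr0.
rewrite -yE [RHS]mxE.
set al := (x *m H *m adjmx y) 0 0; pose be := (y *m H *m adjmx x) 0 0.
have expand t : form H (t *: x + y) = t * al + conjc t * be + form H y.
  rewrite /form; have -> : adjmx (t *: x + y) = conjc t *: adjmx x + adjmx y.
    by apply/matrixP => a b; rewrite !mxE rmorphD rmorphM.
  rewrite !mulmxDl !mulmxDr -!scalemxAl -!scalemxAr.
  rewrite /al /be; move: hx; rewrite /form.
  move: (x *m H *m adjmx x) (x *m H *m adjmx y) (y *m H *m adjmx x) (y *m H *m adjmx y).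
  move=> M1 M2 M3 M4 M10; rewrite !mxE M10; ring.
have pos t : 0 <= t * (c * al) + conjc t * (c * be) + c * form H y.
  by have := psd (t *: x + y); rewrite expand; congr (_ <= _); ring.
suff : c * al = 0 by move/eqP; rewrite mulf_eq0 (negPf c0) orFb => /eqP.
move: (c * al) (c * be) (c * form H y) pos => [a1 a2] [b1 b2] [g1 g2] pos.
(* Real and imaginary [t], each read in the real and in the imaginary part, give four real
   equations. *)
have e1 : a1 + b1 = 0.
  apply: (@affine_ge0_slope _ _ g1) => s.
  have := pos (Complex s 0); rewrite lecE /= => /andP[_]; congr (_ <= _); ring.
have e2 : b2 - a2 = 0.
  apply: (@affine_ge0_slope _ _ g1) => s.
  have := pos (Complex 0 s); rewrite lecE /= => /andP[_]; congr (_ <= _); ring.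
have e3 : a2 + b2 = 0.
  apply: (@affine_ge0_slope _ _ g2) => s.
  have := pos (Complex s 0); rewrite lecE /= => /andP[/eqP h _].
  by rewrite -h le_eqVlt; apply/orP; left; apply/eqP; rewrite h -[LHS]h; ring.
have e4 : a1 - b1 = 0.
  apply: (@affine_ge0_slope _ _ g2) => s.
  have := pos (Complex 0 s); rewrite lecE /= => /andP[/eqP h _].
  by rewrite -h le_eqVlt; apply/orP; left; apply/eqP; rewrite h -[LHS]h; ring.
by congr Complex; lra.
Qed.

(** If [x H = 0], the fixed-point equation writes [0 = c form H x] as a sum of the nonnegative terms
    [c form H (x B_j)]; each vanishes, and [psd_kernel] applies to [x B_j]. *)
Lemma psd_kernel_stable n (H : 'M[C]_n) (c : C) d (B : 'I_d -> 'M[C]_n) : c != 0 ->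
  (forall x, 0 <= c * form H x) -> H = \sum_i B i *m H *m adjmx (B i) ->
  forall i, (kermx H *m B i <= kermx H)%MS.
Proof.
move=> c0 psd hH i; apply/sub_kermxP; apply/row_matrixP => k.
rewrite row0 2!row_mul; set x := row k (kermx H).
have xH : x *m H = 0 by rewrite -row_mul mulmx_ker row0.
apply: (psd_kernel c0 psd).
have : \sum_j c * form H (x *m B j) = 0.
  rewrite -mulr_sumr; have -> : \sum_j form H (x *m B j) = form H x.
    rewrite /form {2}hH mulmx_sumr mulmx_suml summxE; apply: eq_bigr => j _.
    congr (fun_of_matrix _ 0 0); rewrite /adjmx map_mxM trmx_mul !mulmxA.
    by [].
  by rewrite /form xH mul0mx mxE mulr0.
move/eqP; rewrite psumr_eq0 => [|j _]; last exact: psd.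
move/allP/(_ i (mem_index_enum _))/implyP/(_ isT); rewrite mulf_eq0 (negPf c0) orFb => /eqP. exact.
Qed.

End PositiveForms.

(** * Transfer matrices, words, and positivity of the fixed points *)

Section Transfer.
Variables (R : realType) (d D : nat) (A : 'I_d -> 'M[R[i]]_D).
Local Notation C := R[i].
Local Notation cj := (@conjc R).

Definition site_op := 'I_d -> 'I_d -> C.
Definition site_id : site_op := fun a b => (a == b)%:R.

(** The contribution of one site when [o] stands between the conjugated tensor (first factor) and
    the tensor itself. *)
Definition site_transfer (o : site_op) : 'M[C]_(D * D) :=
  \sum_a \sum_b o a b *: (map_mx cj (A a) *t A b).

Definition word N (x : config N d) : 'M[C]_D := \big[mulmx/1%:M]_(j < N) A (x j).

Lemma sum_tens_index (V : nmodType) m n (F : 'I_(m * n) -> V) :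
  \sum_k F k = \sum_i \sum_j F (mxtens_index (i, j)).
Proof.
rewrite pair_bigA (reindex (@mxtens_index m n)) /=.
  by apply: eq_bigr => -[i j].
by exists (@mxtens_unindex m n) => k _; rewrite ?mxtens_indexK ?mxtens_unindexK.
Qed.

Lemma site_transfer_id : site_transfer site_id = transfer A.
Proof.
apply: eq_bigr => a _; rewrite (bigD1 a) //= big1 ?addr0 => [|b ba].
  by rewrite /site_id eqxx scale1r.
by rewrite /site_id eq_sym (negPf ba) scale0r.
Qed.

Lemma tens1mx1 m n : (1%:M : 'M[C]_m) *t (1%:M : 'M[C]_n) = 1%:M.
Proof.
apply/matrixP => k l; case: (mxtens_indexP k) => i j; case: (mxtens_indexP l) => i' j'.
rewrite tensmxE !mxE (inj_eq (can_inj (@mxtens_indexK m n))) xpair_eqE.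
by case: (i == i'); case: (j == j'); rewrite ?mulr1 ?mulr0 ?mul0r.
Qed.

Lemma tens_big_mulmx N (F G : 'I_N -> 'M[C]_D) :
  \big[mulmx/1%:M]_(j < N) (F j *t G j) =
  (\big[mulmx/1%:M]_(j < N) F j) *t (\big[mulmx/1%:M]_(j < N) G j).
Proof.
elim/big_rec3: _ => [|i x y z _ ->]; last by rewrite tensmx_mul.
by rewrite tens1mx1.
Qed.

Lemma map_big_mulmx N (F : 'I_N -> 'M[C]_D) :
  map_mx cj (\big[mulmx/1%:M]_(j < N) F j) = \big[mulmx/1%:M]_(j < N) map_mx cj (F j).
Proof.
elim/big_rec2: _ => [|i x y _ <-]; last by rewrite map_mxM.
by rewrite map_mx1.
Qed.

Lemma big_mulmx_scale n N (c : 'I_N -> C) (F : 'I_N -> 'M[C]_n) :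
  \big[mulmx/1%:M]_(j < N) (c j *: F j) =
  (\prod_j c j) *: \big[mulmx/1%:M]_(j < N) F j.
Proof.
elim/big_rec3: _ => [|i x y z _ ->]; first by rewrite scale1r.
by rewrite -scalemxAl -scalemxAr scalerA.
Qed.

(** Distributivity: expanding the product picks a pair of indices at every site, that is, a pair of
    configurations. *)
Lemma site_transfer_words N (o : 'I_N -> site_op) :
  \big[mulmx/1%:M]_(j < N) site_transfer (o j) =
  \sum_(x : config N d) \sum_(y : config N d)
    (\prod_j o j (x j) (y j)) *: (map_mx cj (word x) *t word y).
Proof.
under eq_bigr => j _ do rewrite /site_transfer pair_bigA.
rewrite -[LHS]/(\prod_(j < N) _) bigA_distr_bigA pair_bigA /=.
pose h (p : config N d * config N d) : {ffun 'I_N -> 'I_d * 'I_d} := [ffun j => (p.1 j, p.2 j)].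
rewrite (reindex h) /=; last first.
  exists (fun f => ([ffun j => (f j).1], [ffun j => (f j).2])) => [[x y]|f] _.
    by congr pair; apply/ffunP => j; rewrite !ffunE.
  by apply/ffunP => j; rewrite !ffunE; case: (f j).
apply: eq_bigr => -[x y] _ /=.
under eq_bigr => j _ do rewrite ffunE /=.
by rewrite big_mulmx_scale tens_big_mulmx map_big_mulmx.
Qed.

Lemma big_mulmx_const n N (M : 'M[C]_n) : \big[mulmx/1%:M]_(j < N) M = M ^+ N.
Proof. by elim: N => [|N IH]; rewrite ?big_ord0 // big_ord_recl IH exprS. Qed.

Lemma transfer_exp N :
  transfer A ^+ N = \sum_(x : config N d) map_mx cj (word x) *t word x.
Proof.
rewrite -big_mulmx_const -site_transfer_id site_transfer_words.
apply: eq_bigr => x _; rewrite (bigD1 x) //= [X in _ + X]big1 ?addr0 => [|y yx].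
  by rewrite big1 ?scale1r // => j _; rewrite /site_id eqxx.
rewrite (_ : \prod_j _ = 0) ?scale0r //.
have /existsP[j xyj] : [exists j, x j != y j].
  rewrite -negb_forall; apply: contra yx => /forallP h.
  by apply/eqP/ffunP => j; rewrite (eqP (h j)).
by apply/eqP; rewrite prodf_seq_eq0; apply/hasP; exists j; rewrite ?mem_index_enum // /site_id (negPf xyj) eqxx.
Qed.

Definition tens_row (x y : 'rV[C]_D) : 'rV[C]_(D * D) :=
  \row_k (x 0 (mxtens_unindex k).1 * y 0 (mxtens_unindex k).2).

Lemma tens_row_mul x y (M N : 'M[C]_D) :
  tens_row x y *m (M *t N) = tens_row (x *m M) (y *m N).
Proof.
apply/rowP => k; case: (mxtens_indexP k) => i j.
rewrite !mxE mxtens_indexK /= sum_tens_index big_distrlr /=.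
apply: eq_bigr => i' _; apply: eq_bigr => j' _.
rewrite mxE mxtens_indexK tensmxE /=; ring.
Qed.

Lemma tens_row_dot x y x' y' :
  (tens_row x y *m (tens_row x' y')^T) 0 0 = (x *m x'^T) 0 0 * (y *m y'^T) 0 0.
Proof.
rewrite !mxE sum_tens_index big_distrlr /=.
apply: eq_bigr => i' _; apply: eq_bigr => j' _.
rewrite !mxE mxtens_indexK /=; ring.
Qed.

(* The entries of a vector of C^D (x) C^D, read as a D x D matrix. *)
Definition mx_of_col (u : 'cV[C]_(D * D)) : 'M[C]_D :=
  \matrix_(i, j) u (mxtens_index (i, j)) 0.
Definition mx_of_row (v : 'rV[C]_(D * D)) : 'M[C]_D :=
  \matrix_(i, j) v 0 (mxtens_index (i, j)).

(** Read as a matrix, a fixed vector is a fixed point of a map in Kraus form, the shape that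
    [psd_kernel_stable] takes. *)
Lemma mx_of_col_fixed u : transfer A *m u = u ->
  mx_of_col u = \sum_i map_mx cj (A i) *m mx_of_col u *m adjmx (map_mx cj (A i)).
Proof.
move=> Eu; apply/matrixP => p p'; rewrite mxE -{1}Eu mulmx_suml !summxE.
apply: eq_bigr => a _; rewrite !mxE sum_tens_index.
transitivity (\sum_i \sum_j (A a p i)^* * u (mxtens_index (i, j)) 0 * A a p' j)%C.
  apply: eq_bigr => i _; apply: eq_bigr => j _; rewrite tensmxE !mxE; ring.
rewrite exchange_big; apply: eq_bigr => j _.
rewrite mxE big_distrl /=; apply: eq_bigr => i _.
by rewrite !mxE conjcK.
Qed.

Lemma mx_of_row_fixed v : v *m transfer A = v ->
  mx_of_row v = \sum_i adjmx (A i) *m mx_of_row v *m adjmx (adjmx (A i)).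
Proof.
move=> Ev; apply/matrixP => q q'; rewrite mxE -{1}Ev mulmx_sumr !summxE.
apply: eq_bigr => a _; rewrite !mxE sum_tens_index exchange_big.
apply: eq_bigr => j _; rewrite mxE big_distrl /=; apply: eq_bigr => i _.
rewrite tensmxE !mxE conjcK; ring.
Qed.

(** Only the product of the two forms is a matrix element of [u v], so only its sign can be read off
    the powers of the transfer matrix. *)
Lemma form_mx_of (u : 'cV[C]_(D * D)) (v : 'rV[C]_(D * D)) x y :
  form (mx_of_col u) x * form (mx_of_row v) y =
  (tens_row x (map_mx cj x) *m (u *m v) *m (tens_row y (map_mx cj y))^T) 0 0.
Proof.
rewrite mulmxA -mulmxA [RHS]mxE big_ord1; congr (_ * _).
  rewrite /form [LHS]mxE [RHS]mxE sum_tens_index exchange_big; apply: eq_bigr => j _.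
  rewrite !mxE big_distrl /=; apply: eq_bigr => i _.
  rewrite !mxE mxtens_indexK /=; ring.
rewrite /form [LHS]mxE [RHS]mxE sum_tens_index exchange_big; apply: eq_bigr => j _.
rewrite !mxE big_distrl /=; apply: eq_bigr => i _.
rewrite !mxE mxtens_indexK /=; ring.
Qed.

(** Each word [W] contributes the squared modulus of [x conj(W) y^T]. *)
Lemma form_transfer_ge0 N x y :
  0 <= (tens_row x (map_mx cj x) *m transfer A ^+ N *m (tens_row y (map_mx cj y))^T) 0 0.
Proof.
rewrite transfer_exp mulmx_sumr mulmx_suml summxE sumr_ge0 // => w _.
rewrite tens_row_mul tens_row_dot.
have -> : map_mx cj x *m word w *m (map_mx cj y)^T = map_mx cj (x *m map_mx cj (word w) *m y^T).
  have WW : map_mx cj (map_mx cj (word w)) = word w.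
    by apply/matrixP => i j; rewrite !mxE conjcK.
  by rewrite !map_mxM WW map_trmx.
by rewrite [X in _ * X]mxE mulcJ_ge0.
Qed.

Lemma form_limit_ge0 u v K rho : 0 < rho -> rho < 1 ->
    (forall m i j, cabs ((transfer A ^+ m - u *m v) i j) <= K * rho ^+ m) ->
  forall x y, 0 <= form (mx_of_col u) x * form (mx_of_row v) y.
Proof.
move=> rho0 rho1 hK x y; rewrite form_mx_of.
set a := tens_row x _; set b := tens_row y _.
pose c := \sum_k \sum_l cabs (a 0 k) * cabs (b 0 l).
apply: (@cvg_ge0 _ _ _ rho (c * K) rho0 rho1 _ (fun m => form_transfer_ge0 m x y)) => m.
rewrite -/a -/b.
have -> : (a *m transfer A ^+ m *m b^T) 0 0 - (a *m (u *m v) *m b^T) 0 0 =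
    (a *m (transfer A ^+ m - u *m v) *m b^T) 0 0.
  rewrite mulmxBr mulmxBl.
  by move: (a *m transfer A ^+ m *m b^T) (a *m (u *m v) *m b^T) => X Y; rewrite !mxE.
rewrite mxE; apply: le_trans (cabs_sum _ _ _) _.
rewrite /c exchange_big -mulrA mulr_suml; apply: ler_sum => l _.
rewrite cabsM [b^T _ _]mxE [(a *m _) _ _]mxE.
apply: le_trans (ler_wpM2r (cabs_ge0 _) (cabs_sum _ _ _)) _.
rewrite !mulr_suml; apply: ler_sum => k _; rewrite cabsM.
rewrite -!mulrA ler_wpM2l ?cabs_ge0 // mulrC.
by rewrite ler_wpM2l ?cabs_ge0.
Qed.

Lemma map_conj_submx m1 m2 n (M : 'M[C]_(m1, n)) (N : 'M[C]_(m2, n)) :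
  (M <= N)%MS -> (map_mx cj M <= map_mx cj N)%MS.
Proof. by rewrite map_submx. Qed.

(** By [psd_kernel_stable] the kernels of the two fixed points are stable under the conjugates,
    respectively the adjoints, of the [A i]; irreducibility then makes them trivial. *)
Lemma fixed_points_unitmx u v K rho : irreducible_tensor A ->
    transfer A *m u = u -> v *m transfer A = v -> v *m u = 1%:M ->
    0 < rho -> rho < 1 ->
    (forall m i j, cabs ((transfer A ^+ m - u *m v) i j) <= K * rho ^+ m) ->
  mx_of_col u \in unitmx /\ mx_of_row v \in unitmx.
Proof.
move=> irr Eu vE vu rho0 rho1 hK.
have psd := form_limit_ge0 rho0 rho1 hK.
have u0 : mx_of_col u != 0.
  apply: contra_eqN vu => /eqP u0; apply/eqP => /matrixP/(_ 0 0); rewrite !mxE eqxx.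
  rewrite sum_tens_index big1 => [/eqP|i _]; first by rewrite eq_sym oner_eq0.
  by rewrite big1 // => j _; have /matrixP/(_ i j) := u0; rewrite !mxE => ->; rewrite mulr0.
have v0 : mx_of_row v != 0.
  apply: contra_eqN vu => /eqP v0; apply/eqP => /matrixP/(_ 0 0); rewrite !mxE eqxx.
  rewrite sum_tens_index big1 => [/eqP|i _]; first by rewrite eq_sym oner_eq0.
  by rewrite big1 // => j _; have /matrixP/(_ i j) := v0; rewrite !mxE => ->; rewrite mul0r.
have form_neq0 (H : 'M[C]_D) : H != 0 -> exists x, form H x != 0.
  move=> H0; have [//|h] := boolp.pselect (exists x, form H x != 0).
  case/eqP: H0; rewrite -[H]mul1mx; apply/row_matrixP => i; rewrite row_mul row0.
  have h0 x : form H x = 0 by apply/eqP/negPn/negP => hx; apply: h; exists x.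
  by apply: (@psd_kernel _ _ _ 1) => [|x|//]; rewrite ?oner_neq0 // h0 mulr0.
(* Freezing one form at a nonzero value turns it into the scalar [c] that makes the other
   nonnegative. *)
have [x0 hx0] := form_neq0 _ u0; have [y0 hy0] := form_neq0 _ v0.
have psdv y : 0 <= form (mx_of_col u) x0 * form (mx_of_row v) y by [].
have psdu x : 0 <= form (mx_of_row v) y0 * form (mx_of_col u) x by rewrite mulrC.
have kv := psd_kernel_stable hx0 psdv (mx_of_row_fixed vE).
have ku := psd_kernel_stable hy0 psdu (mx_of_col_fixed Eu).
split; last first.
  have [i||] := irr (map_mx cj (kermx (mx_of_row v))).
  - have -> : (A i)^T = map_mx cj (adjmx (A i)) by apply/matrixP => a b; rewrite !mxE conjcK.
    by rewrite -map_mxM; apply: map_conj_submx; exact: kv.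
  - move/eqP; rewrite mxrank_map mxrank_ker subn_eq0.
    by rewrite -row_free_unit row_leq_rank.
  rewrite -col_leq_rank mxrank_map mxrank_ker => h.
  have : \rank (mx_of_row v) = 0%N.
    have := rank_leq_row (mx_of_row v); move: h; lia.
  by move/eqP; rewrite mxrank_eq0 (negPf v0).
(* [L] is stable under the [A i], while irreducibility speaks of their transposes; the annihilator
   [kermx L^T] is stable under those. *)
set L := map_mx cj (kermx (mx_of_col u)).
have LA i : (L *m A i <= L)%MS.
  have -> : A i = map_mx cj (map_mx cj (A i)) by apply/matrixP => a b; rewrite !mxE conjcK.
  by rewrite -map_mxM; apply: map_conj_submx; exact: ku.
have rkL : \rank (kermx L^T) = \rank (mx_of_col u).
  rewrite mxrank_ker mxrank_tr mxrank_map mxrank_ker subKn //.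
  exact: rank_leq_row.
have [i||] := irr (kermx L^T).
- apply/sub_kermxP; have /submxP[Z hZ] := LA i.
  by rewrite -mulmxA -trmx_mul hZ trmx_mul mulmxA mulmx_ker mul0mx.
- by rewrite rkL => /eqP; rewrite mxrank_eq0 (negPf u0).
by rewrite -col_leq_rank rkL col_leq_rank row_full_unit.
Qed.

End Transfer.

(** * From invertible fixed points to words that span all matrices *)

Section Injectivity.
Variable R : realType.
Local Notation C := R[i].
Local Notation cj := (@conjc R).

(** A row [x] in the kernel satisfies [x = - x M], so its l1 norm is at most [n e] times itself. *)
Lemma small_perturbation_unitmx n (M : 'M[C]_n) (e : R) :
  (forall i j, cabs (M i j) <= e) -> n%:R * e < 1 -> 1%:M + M \in unitmx.
Proof.
move=> Me ne1; rewrite -row_free_unit -kermx_eq0; apply/eqP/row_matrixP => k.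
rewrite row0; set x := row k _.
have xM : x = - (x *m M).
  apply/eqP; rewrite -addr_eq0 -{1}[x]mulmx1 -mulmxDr; apply/eqP.
  by rewrite -row_mul mulmx_ker row0.
pose s := \sum_j cabs (x 0 j).
have s0 : 0 <= s by apply: sumr_ge0 => j _; exact: cabs_ge0.
have sle : s <= n%:R * e * s.
  have hj j : cabs (x 0 j) <= s * e.
    rewrite {1}xM mxE cabsN mxE mulr_suml; apply: le_trans (cabs_sum _ _ _) _.
    by apply: ler_sum => i _; rewrite cabsM ler_wpM2l ?cabs_ge0.
  apply: le_trans (ler_sum _ (fun j _ => hj j)) _.
  by rewrite sumr_const card_ord -[X in X <= _]mulr_natl mulrCA mulrC.
have : s = 0 by nra.
move/eqP; rewrite psumr_eq0 => [/allP h|j _]; last exact: cabs_ge0.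
apply/rowP => j; rewrite [RHS]mxE; apply/eqP; rewrite -cabs_eq0.
exact: h (mem_index_enum _).
Qed.

Lemma unitmx_of_limit n (S : nat -> 'M[C]_n) (S0 : 'M[C]_n) K rho :
    0 < rho -> rho < 1 -> S0 \in unitmx ->
    (forall m i j, cabs ((S m - S0) i j) <= K * rho ^+ m) ->
  exists m, S m \in unitmx.
Proof.
move=> rho0 rho1 uS hK.
pose c := \sum_i \sum_j cabs (invmx S0 i j).
have c0 i : 0 <= \sum_j cabs (invmx S0 i j) by apply: sumr_ge0 => j _; exact: cabs_ge0.
have [M hM] := expr_small (n%:R * (c * K)) rho0 rho1 ltr01.
(* [S M] is written as [S0 (1 + S0^-1 (S M - S0))]. *)
exists M; rewrite -[S M](subrK S0) addrC -[S M - S0](mulKVmx uS) -[X in X + _]mulmx1 -mulmxDr.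
rewrite unitmx_mul uS; apply: (@small_perturbation_unitmx _ _ (c * K * rho ^+ M)); last first.
  by have := hM M (leqnn M); rewrite !mulrA.
move=> i j; rewrite mxE; apply: le_trans (cabs_sum _ _ _) _.
apply: le_trans (_ : \sum_k cabs (invmx S0 i k) * (K * rho ^+ M) <= _).
  by apply: ler_sum => k _; rewrite cabsM ler_wpM2l ?cabs_ge0.
rewrite -mulr_suml -mulrA ler_wpM2r //; last first.
  by rewrite /c [X in _ <= X](bigD1 i) //= lerDl sumr_ge0.
by apply: le_trans (hK M i j); exact: cabs_ge0.
Qed.

Variables (d D : nat) (A : 'I_d -> 'M[C]_D).

(** The realignment map: it turns [conj W] tensor [W] into the rank-one product of the two
    vectorized words, and [u v] into the tensor product of the matrices read off [u] and [v]. *)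
Definition reshuffle (M : 'M[C]_(D * D)) : 'M[C]_(D * D) :=
  \matrix_(i, j) M (mxtens_index ((mxtens_unindex i).1, (mxtens_unindex j).1))
                   (mxtens_index ((mxtens_unindex i).2, (mxtens_unindex j).2)).

(* The Gram matrix of the words of length [m] is the reshuffled [m]-th power of
   the transfer matrix, whose limit is a tensor product of invertible matrices. *)
Lemma words_span (u : 'cV[C]_(D * D)) (v : 'rV[C]_(D * D)) K rho :
    irreducible_tensor A -> (0 < D)%N ->
    transfer A *m u = u -> v *m transfer A = v -> v *m u = 1%:M ->
    0 < rho -> rho < 1 ->
    (forall m i j, cabs ((transfer A ^+ m - u *m v) i j) <= K * rho ^+ m) ->
  exists l (B : 'I_D -> 'I_D -> config l d -> C), forall i j p q,
    \sum_w B i j w * word A w p q = ((p == i) && (q == j))%:R.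
Proof.
move=> irr D0 Eu vE vu rho0 rho1 hK.
have [uu uv] := fixed_points_unitmx irr Eu vE vu rho0 rho1 hK.
have hS m i j : cabs ((reshuffle (transfer A ^+ m) - mx_of_col u *t mx_of_row v) i j)
    <= K * rho ^+ m.
  case: (mxtens_indexP i) => p q; case: (mxtens_indexP j) => p' q'.
  have := hK m (mxtens_index (p, p')) (mxtens_index (q, q')).
  congr (cabs _ <= _); rewrite [LHS]mxE [RHS]mxE; congr (_ + _).
    by rewrite mxE !mxtens_indexK.
  by rewrite mxE [RHS]mxE tensmxE !mxE big_ord1.
have [|m um] := unitmx_of_limit rho0 rho1 _ hS.
  by rewrite tensmx_unit // -lt0n.
(* Each row of [W] is a vectorized word, so a left inverse of [W] expresses the matrix units through
   words. *)
pose W : 'M[C]_(#|{: config m d}|, D * D) := \matrix_(a, k)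
  word A (enum_val a) (mxtens_unindex k).1 (mxtens_unindex k).2.
have WW : reshuffle (transfer A ^+ m) = adjmx W *m W.
  apply/matrixP => i j; rewrite mxE transfer_exp summxE mxE.
  rewrite (reindex_onto enum_val enum_rank) => [|w _]; last exact: enum_rankK.
  rewrite [LHS](eq_bigl predT) => [|a]; last by rewrite enum_valK eqxx.
  apply: eq_bigr => a _; rewrite tensmxE !mxE.
  by [].
pose Z := invmx (reshuffle (transfer A ^+ m)) *m adjmx W.
have ZW : Z *m W = 1%:M by rewrite -mulmxA -WW mulVmx.
exists m, (fun i j w => Z (mxtens_index (i, j)) (enum_rank w)) => i j p q.
have := congr1 (fun M : 'M_(_, _) => M (mxtens_index (i, j)) (mxtens_index (p, q))) ZW.
rewrite /= !mxE (inj_eq (can_inj (@mxtens_indexK D D))) xpair_eqE => h.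
rewrite [p == i]eq_sym [q == j]eq_sym -[RHS]h.
rewrite [RHS](reindex_onto enum_rank enum_val) => [|a _]; last exact: enum_valK.
rewrite [RHS](eq_bigl predT) => [|w]; last by rewrite enum_rankK eqxx.
by apply: eq_bigr => w _; rewrite [X in _ = _ * X]mxE enum_rankK mxtens_indexK.
Qed.

(** The representable matrices form a subspace, and a matrix unit of the tensor product is obtained
    from the coefficients [B] of its two factors, conjugated for the first. *)
Lemma transfer_surjective l (B : 'I_D -> 'I_D -> config l d -> C) :
    (forall i j p q, \sum_w B i j w * word A w p q = ((p == i) && (q == j))%:R) ->
  forall G : 'M[C]_(D * D), exists X : config l d -> config l d -> C,
    \sum_a \sum_b X a b *: (map_mx cj (word A a) *t word A b) = G.
Proof.
move=> hB G; rewrite [G]matrix_sum_delta.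
pose rep (M : 'M[C]_(D * D)) := exists X : config l d -> config l d -> C,
  \sum_a \sum_b X a b *: (map_mx cj (word A a) *t word A b) = M.
have rep_add M N : rep M -> rep N -> rep (M + N).
  move=> [X <-] [Y <-]; exists (fun a b => X a b + Y a b).
  by rewrite -big_split; apply: eq_bigr => a _; rewrite -big_split; apply: eq_bigr => b _; rewrite scalerDl.
have rep_scale c M : rep M -> rep (c *: M).
  move=> [X <-]; exists (fun a b => c * X a b).
  by rewrite scaler_sumr; apply: eq_bigr => a _; rewrite scaler_sumr; apply: eq_bigr => b _; rewrite scalerA.
have rep0 : rep 0 by exists (fun _ _ => 0); rewrite big1 // => a _; rewrite big1 // => b _; rewrite scale0r.
apply: (@big_ind _ rep) => // k _; apply: (@big_ind _ rep) => // k' _; apply: rep_scale.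
case: (mxtens_indexP k) => i i'; case: (mxtens_indexP k') => j j'.
exists (fun a b => cj (B i j a) * B i' j' b).
have hBc p q : \sum_a cj (B i j a) * cj (word A a p q) = ((p == i) && (q == j))%:R.
  rewrite -[RHS]conjc_nat -hB rmorph_sum /=; apply: eq_bigr => a _.
  by rewrite rmorphM.
apply/matrixP => x x'; case: (mxtens_indexP x) => p p'; case: (mxtens_indexP x') => q q'.
transitivity ((\sum_a cj (B i j a) * cj (word A a p q)) * (\sum_b B i' j' b * word A b p' q')).
  rewrite big_distrlr /= summxE; apply: eq_bigr => a _; rewrite summxE; apply: eq_bigr => b _.
  rewrite mxE tensmxE mxE; ring.
rewrite hBc hB mxE !(inj_eq (can_inj (@mxtens_indexK D D))) !xpair_eqE.
by case: (p == i); case: (q == j); case: (p' == i'); case: (q' == j'); rewrite ?mulr1 ?mulr0 ?mul0r.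
Qed.

End Injectivity.

(** * Local operators and circuits *)

Section Operators.
Variables (R : realType) (N d : nat).
Local Notation C := R[i].
Local Notation cj := (@conjc R).
Local Notation op := (op R N d).
Local Notation state := (state R N d).
Local Notation config := (config N d).
Local Notation site_op := (site_op R d).
Implicit Types (G H O : op) (v w : state) (S : {set 'I_N}).

Definition opmul G H : op := fun x y => \sum_z G x z * H z y.
Definition opadj G : op := fun x y => cj (G y x).
Definition opid : op := fun x y => (x == y)%:R.
(** Not divided by the norm, so that it serves the raw matrix product state as well. *)
Definition ev v O : C := dot v (apply_op O v).

Lemma op_ext G H : (forall x y, G x y = H x y) -> G = H.
Proof. by move=> h; apply: boolp.funext => x; apply: boolp.funext => y. Qed.

Lemma opmulA G H O : opmul G (opmul H O) = opmul (opmul G H) O.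
Proof.
apply: op_ext => x y; rewrite /opmul.
under eq_bigr => z _ do rewrite big_distrr /=.
rewrite exchange_big; apply: eq_bigr => z' _ /=; rewrite big_distrl /=.
by apply: eq_bigr => z _; rewrite mulrA.
Qed.

Lemma opmul1 G : opmul G opid = G.
Proof.
apply: op_ext => x y; rewrite /opmul (bigD1 y) //= /opid eqxx mulr1 big1 ?addr0 // => z zy.
by rewrite (negPf zy) mulr0.
Qed.

Lemma op1mul G : opmul opid G = G.
Proof.
apply: op_ext => x y; rewrite /opmul (bigD1 x) //= /opid eqxx mul1r big1 ?addr0 // => z zx.
by rewrite eq_sym (negPf zx) mul0r.
Qed.

Lemma opadjK G : opadj (opadj G) = G.
Proof. by apply: op_ext => x y; rewrite /opadj conjcK. Qed.

Lemma opadj_mul G H : opadj (opmul G H) = opmul (opadj H) (opadj G).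
Proof.
apply: op_ext => x y; rewrite /opadj /opmul rmorph_sum; apply: eq_bigr => z _ /=.
by rewrite rmorphM mulrC.
Qed.

Lemma opadj1 : opadj opid = opid.
Proof. by apply: op_ext => x y; rewrite /opadj /opid conjc_nat eq_sym. Qed.

Lemma apply_opid v : apply_op opid v = v.
Proof.
apply: boolp.funext => x; rewrite /apply_op (bigD1 x) //= /opid eqxx mul1r big1 ?addr0 // => z zx.
by rewrite eq_sym (negPf zx) mul0r.
Qed.

Lemma apply_op_mul G H v : apply_op (opmul G H) v = apply_op G (apply_op H v).
Proof.
apply: boolp.funext => x; rewrite /apply_op /opmul.
under [RHS]eq_bigr => z _ do rewrite big_distrr /=.
rewrite exchange_big; apply: eq_bigr => y _ /=; rewrite big_distrl /=.
by apply: eq_bigr => z _; rewrite mulrA.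
Qed.

Lemma dot_apply_op v G w : dot v (apply_op G w) = dot (apply_op (opadj G) v) w.
Proof.
rewrite /dot /apply_op.
under eq_bigr => x _ do rewrite big_distrr /=.
rewrite exchange_big; apply: eq_bigr => y _ /=; rewrite rmorph_sum big_distrl /=.
by apply: eq_bigr => x _; rewrite rmorphM /= /opadj conjcK; ring.
Qed.

Lemma ev_apply G v O : ev (apply_op G v) O = ev v (opmul (opadj G) (opmul O G)).
Proof. by rewrite /ev !apply_op_mul [RHS]dot_apply_op opadjK. Qed.

Lemma apply_op_inj G H : (forall v, apply_op G v = apply_op H v) -> G = H.
Proof.
have app O x y : apply_op O (fun z => (z == y)%:R) x = O x y.
  rewrite /apply_op (bigD1 y) //= eqxx mulr1 big1 ?addr0 // => z zy.
  by rewrite (negPf zy) mulr0.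
by move=> h; apply: op_ext => x y; rewrite -!app h.
Qed.

Lemma unitary_opl G : unitary_op G -> opmul (opadj G) G = opid.
Proof. by move=> uG; apply: op_ext => x y; rewrite /opmul /opadj uG. Qed.

(** In finite dimension a left inverse is a right inverse; operators become matrices by enumerating
    configurations. *)
Lemma unitary_opr G : unitary_op G -> opmul G (opadj G) = opid.
Proof.
move=> /unitary_opl uG.
pose M O : 'M[C]_#|{: config}| := \matrix_(i, j) O (enum_val i) (enum_val j).
have MM O O' : M O *m M O' = M (opmul O O').
  apply/matrixP => i j; rewrite !mxE /opmul [RHS](reindex_onto enum_val enum_rank) => [|w _]; last exact: enum_rankK.
  rewrite [RHS](eq_bigl predT) => [|a]; last by rewrite enum_valK eqxx.
  by apply: eq_bigr => a _; rewrite !mxE.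
have M1 : M opid = 1%:M.
  by apply/matrixP => i j; rewrite !mxE /opid (inj_eq enum_val_inj).
have : M (opadj G) *m M G = 1%:M by rewrite MM uG.
move/mulmx1C; rewrite MM -M1 => h; apply: op_ext => x y.
have := congr1 (fun M : 'M_(_, _) => M (enum_rank x) (enum_rank y)) h.
by rewrite !mxE !enum_rankK.
Qed.

Definition site_mul (o o' : site_op) : site_op := fun a b => \sum_c o a c * o' c b.
Definition site_adj (o : site_op) : site_op := fun a b => cj (o b a).

Lemma site_op_ext (o o' : site_op) : (forall a b, o a b = o' a b) -> o = o'.
Proof. by move=> h; apply: boolp.funext => x; apply: boolp.funext => y. Qed.

Lemma site_mul1 o : site_mul o (@site_id R d) = o.
Proof.
apply: site_op_ext => x y; rewrite /site_mul (bigD1 y) //= /site_id eqxx mulr1 big1 ?addr0 // => z zy.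
by rewrite (negPf zy) mulr0.
Qed.

Lemma site_1mul o : site_mul (@site_id R d) o = o.
Proof.
apply: site_op_ext => x y; rewrite /site_mul (bigD1 x) //= /site_id eqxx mul1r big1 ?addr0 // => z zx.
by rewrite eq_sym (negPf zx) mul0r.
Qed.

Lemma site_adj1 : site_adj (@site_id R d) = @site_id R d.
Proof. by apply: site_op_ext => x y; rewrite /site_adj /site_id conjc_nat eq_sym. Qed.

Definition pop (u : 'I_N -> site_op) : op := fun x y => \prod_j u j (x j) (y j).

Lemma pop_mul u u' : opmul (pop u) (pop u') = pop (fun j => site_mul (u j) (u' j)).
Proof.
apply: op_ext => x y; rewrite /opmul /pop /site_mul bigA_distr_bigA.
by apply: eq_bigr => z _; rewrite -big_split.
Qed.

Lemma pop_adj u : opadj (pop u) = pop (fun j => site_adj (u j)).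
Proof. by apply: op_ext => x y; rewrite /opadj /pop rmorph_prod. Qed.

Definition opsum (Q : finType) (c : Q -> C) (O : Q -> op) : op :=
  fun x y => \sum_q c q * O q x y.

Lemma opsum_mul (Q Q' : finType) (c : Q -> C) (c' : Q' -> C) (O : Q -> op) (O' : Q' -> op) :
  opmul (opsum c O) (opsum c' O') =
  opsum (fun q : Q * Q' => c q.1 * c' q.2) (fun q => opmul (O q.1) (O' q.2)).
Proof.
apply: op_ext => x y; rewrite /opmul /opsum.
rewrite -(pair_bigA _ (fun i j => c i * c' j * \sum_z O i x z * O' j z y)) /=.
under eq_bigr => z _ do rewrite big_distrlr /=.
rewrite exchange_big; apply: eq_bigr => q _ /=.
rewrite exchange_big; apply: eq_bigr => q' _ /=.
rewrite big_distrr /=; apply: eq_bigr => z _; ring.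
Qed.

Lemma opsum_adj (Q : finType) (c : Q -> C) (O : Q -> op) :
  opadj (opsum c O) = opsum (fun q => cj (c q)) (fun q => opadj (O q)).
Proof.
apply: op_ext => x y; rewrite /opadj /opsum rmorph_sum; apply: eq_bigr => q _ /=.
by rewrite rmorphM.
Qed.

Lemma ev_opsum (Q : finType) (c : Q -> C) (O : Q -> op) v :
  ev v (opsum c O) = \sum_q c q * ev v (O q).
Proof.
rewrite /ev /dot /apply_op /opsum.
under eq_bigr => x _ do under eq_bigr => y _ do rewrite big_distrl /=.
under eq_bigr => x _.
  rewrite exchange_big big_distrr /=.
  under eq_bigr => q _ do rewrite big_distrr /=.
  over.
rewrite exchange_big; apply: eq_bigr => q _ /=.
rewrite big_distrr /=; apply: eq_bigr => x _.
rewrite !big_distrr /=; apply: eq_bigr => y _; ring.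
Qed.

(** Encoded by sums of product operators, so that products, commutation and factorization are
    checked site by site. *)
Definition local_op S O := exists (Q : finType) (c : Q -> C) (u : Q -> 'I_N -> site_op),
  (forall q i, i \notin S -> u q i = @site_id R d) /\ O = opsum c (fun q => pop (u q)).

Lemma local_op_sub S S' O : S \subset S' -> local_op S O -> local_op S' O.
Proof.
move=> sSS' [Q [c [u [hu ->]]]]; exists Q, c, u; split => // q i iS'.
by apply: hu; apply: contra iS'; apply: (subsetP sSS').
Qed.

Lemma local_op_mul S S' O O' : local_op S O -> local_op S' O' -> local_op (S :|: S') (opmul O O').
Proof.
move=> [Q [c [u [hu ->]]]] [Q' [c' [u' [hu' ->]]]].
exists (Q * Q')%type, (fun q => c q.1 * c' q.2), (fun q i => site_mul (u q.1 i) (u' q.2 i)).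
split => [q i|]; first by rewrite inE negb_or => /andP[iS iS']; rewrite hu // hu' // site_mul1.
rewrite opsum_mul; congr opsum; apply: boolp.funext => q.
exact: pop_mul.
Qed.

Lemma local_op_adj S O : local_op S O -> local_op S (opadj O).
Proof.
move=> [Q [c [u [hu ->]]]].
exists Q, (fun q => cj (c q)), (fun q i => site_adj (u q i)).
split => [q i iS|]; first by rewrite hu // site_adj1.
rewrite opsum_adj; congr opsum; apply: boolp.funext => q.
exact: pop_adj.
Qed.

Lemma local_op_comm S S' O O' : [disjoint S & S'] -> local_op S O -> local_op S' O' ->
  opmul O O' = opmul O' O.
Proof.
move=> dSS' [Q [c [u [hu ->]]]] [Q' [c' [u' [hu' ->]]]].
rewrite !opsum_mul; apply: op_ext => x y; rewrite /opsum.
rewrite (reindex (fun q : Q' * Q => (q.2, q.1))) /=; last first.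
  by exists (fun q => (q.2, q.1)) => -[].
apply: eq_bigr => q _; rewrite [c _ * _]mulrC; congr (_ * _).
rewrite !pop_mul /pop; apply: eq_bigr => j _.
have [jS|jS] := boolP (j \in S).
  by rewrite (hu' _ j) ?site_mul1 ?site_1mul // (disjointFr dSS').
by rewrite (hu _ j) ?site_mul1 ?site_1mul.
Qed.

(** Expansion of [O] into matrix units on the sites of [S]. A configuration of [S] is represented by
    the full one that agrees with [x0] off [S], so each is counted once. *)
Lemma local_of_acts_on (x0 : config) S O : acts_on S O -> local_op S O.
Proof.
move=> [hoff hon].
exists (config * config)%type,
  (fun q : config * config => if agree_off S q.1 x0 && agree_off S q.2 x0 then O q.1 q.2 else 0),
  (fun (q : config * config) i => if i \in S then (fun a b => (a == q.1 i)%:R * (b == q.2 i)%:R) else @site_id R d).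
split => [q i iS|]; first by rewrite (negPf iS).
apply: op_ext => x y; rewrite /opsum /pop.
pose res (z : config) : config := [ffun i => if i \in S then z i else x0 i].
have res_off z : agree_off S (res z) x0.
  by apply/forall_inP => i; rewrite inE => iS; rewrite ffunE (negPf iS).
have res_on z : agree_on S (res z) z.
  by apply/forall_inP => i iS; rewrite ffunE iS.
have resP (a z : config) : agree_off S a x0 -> (forall i, i \in S -> z i = a i) -> a = res z.
  move=> /forall_inP h1 h2; apply/ffunP => i; rewrite ffunE.
  by case: ifP => iS; [rewrite h2 | apply/eqP/h1; rewrite inE iS].
rewrite (bigD1 (res x, res y)) //= !res_off /= [X in _ + X]big1 ?addr0; last first.
  move=> [a b] /= ne; case: ifP => [/andP[a0 b0]|]; last by rewrite mul0r.
  rewrite [X in _ * X](_ : _ = 0) ?mulr0 //; apply/eqP/negPn/negP => nz.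
  case/negP: ne; rewrite xpair_eqE; apply/andP.
  have h i : i \in S -> (x i == a i) && (y i == b i).
    move=> iS; apply/negPn/negP => xa; case/negP: nz; rewrite (bigD1 i) //= iS.
    by case/nandP: xa => /negPf->; rewrite ?mul0r ?mulr0 ?mul0r.
  by split; apply/eqP/resP => // i /h /andP[/eqP ? /eqP ?].
have [off|off] := boolP (agree_off S x y).
  rewrite big1 ?mulr1 => [|i _]; last first.
    case: ifP => iS; first by rewrite !ffunE iS !eqxx mulr1.
    have xy : x i = y i by apply/eqP; apply: (forall_inP off); rewrite inE iS.
    by rewrite xy /site_id eqxx.
  apply: hon => //; try by apply/forall_inP => i iS; rewrite eq_sym; apply: (forall_inP (res_on _)).
  apply/forall_inP => i; rewrite inE => /negPf iS; rewrite !ffunE iS.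
  by [].
rewrite hoff // [X in _ * X](_ : _ = 0) ?mulr0 //.
case/forall_inPn: off => i; rewrite inE => /negPf iS xy.
by rewrite (bigD1 i) //= iS /site_id (negPf xy) mul0r.
Qed.

Lemma ev_pop_product (p : 'I_N -> 'I_d -> C) u :
  ev (fun x => \prod_j p j (x j)) (pop u) =
  \prod_j \sum_a \sum_b cj (p j a) * (u j a b * p j b).
Proof.
rewrite bigA_distr_bigA; apply: eq_bigr => x _.
rewrite bigA_distr_bigA /apply_op big_distrr /=; apply: eq_bigr => y _.
by rewrite rmorph_prod /pop -!big_split.
Qed.

(** At each site at most one of the two operators differs from the identity, whose expectation at a
    normalized site is 1. *)
Lemma ev_mul_product v S S' O O' : product_state v -> [disjoint S & S'] ->
  local_op S O -> local_op S' O' -> ev v (opmul O O') = ev v O * ev v O'.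
Proof.
move=> [p [p1 /boolp.funext->]] dSS' [Q [c [u [hu ->]]]] [Q' [c' [u' [hu' ->]]]].
rewrite opsum_mul !ev_opsum big_distrlr pair_bigA /=; apply: eq_bigr => q _.
rewrite mulrACA; congr (_ * _).
rewrite pop_mul !ev_pop_product -big_split; apply: eq_bigr => j _ /=.
have id1 : \sum_a \sum_b cj (p j a) * (@site_id R d a b * p j b) = 1.
  transitivity ((\sum_a cabs (p j a) ^+ 2)%:C%C); last by rewrite p1.
  rewrite rmorph_sum; apply: eq_bigr => a _; rewrite (bigD1 a) //= big1 ?addr0 => [|b ba].
    by rewrite /site_id eqxx mul1r mulJc.
  by rewrite /site_id eq_sym (negPf ba) mul0r mulr0.
have [jS|jS] := boolP (j \in S).
  by rewrite (hu' _ j) ?site_mul1 ?id1 ?mulr1 // (disjointFr dSS').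
by rewrite (hu _ j) ?site_1mul ?id1 ?mul1r.
Qed.

Lemma ev_opid v : ev v opid = dot v v.
Proof. by rewrite /ev apply_opid. Qed.

Lemma opid_pop : opid = pop (fun _ => @site_id R d).
Proof.
apply: op_ext => x y; rewrite /opid /pop; have [->|xy] := eqVneq x y.
  by rewrite big1 // => j _; rewrite /site_id eqxx.
have /existsP[j xyj] : [exists j, x j != y j].
  rewrite -negb_forall; apply: contra xy => /forallP h.
  by apply/eqP/ffunP => j; rewrite (eqP (h j)).
by rewrite (bigD1 j) //= /site_id (negPf xyj) mul0r.
Qed.

Lemma product_state_norm v : product_state v -> ev v opid = 1.
Proof.
move=> [p [p1 /boolp.funext->]].
rewrite opid_pop ev_pop_product big1 // => j _.
transitivity ((\sum_a cabs (p j a) ^+ 2)%:C%C); last by rewrite p1.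
rewrite rmorph_sum; apply: eq_bigr => a _; rewrite (bigD1 a) //= big1 ?addr0 => [|b ba].
  by rewrite /site_id eqxx mul1r mulJc.
by rewrite /site_id eq_sym (negPf ba) mul0r mulr0.
Qed.

End Operators.

(** * Light cones of circuits *)

Section Circuits.
Variables (R : realType) (N d : nat).
Local Notation C := R[i].
Local Notation op := (op R N d).
Local Notation state := (state R N d).
Local Notation config := (config N d).
Local Notation opid := (@opid R N d).

Definition sites (a b : nat) : {set 'I_N} := [set i : 'I_N | (a <= i < b)%N].

(* Correlations vanish between windows that stay disjoint, and away from the ends
   of the chain, when enlarged by [w]. *)
Definition factorizing (v : state) (w : nat) := forall a b a' b' (O O' : op),
  (w <= a)%N -> (b + w <= N)%N -> (w <= a')%N -> (b' + w <= N)%N ->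
  (b + 2 * w <= a')%N ->
  local_op (sites a b) O -> local_op (sites a' b') O' ->
  ev v (opmul O O') = ev v O * ev v O'.

(** The Heisenberg picture: [W] acts on the observable instead of the state. *)
Definition conj_op (W O : op) : op := opmul (opadj W) (opmul O W).

Lemma conj_op_mul W O O' : opmul W (opadj W) = opid ->
  conj_op W (opmul O O') = opmul (conj_op W O) (conj_op W O').
Proof.
move=> WW; rewrite /conj_op -!opmulA; congr (opmul _ (opmul _ _)).
by rewrite [opmul W (opmul _ _)]opmulA WW op1mul.
Qed.

Section Layer.
Variables (n : nat) (S : 'I_n -> {set 'I_N}) (G : 'I_n -> op).

Definition layer_op (l : seq 'I_n) : op := foldr (fun j W => opmul (G j) W) opid l.

Lemma apply_layer_op l v :
  apply_op (layer_op l) v = foldr (fun j w => apply_op (G j) w) v l.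
Proof. by elim: l => [|j l IH] /=; rewrite ?apply_opid // apply_op_mul IH. Qed.

Lemma conj_op_comp G1 W O : conj_op (opmul G1 W) O = conj_op W (conj_op G1 O).
Proof. by rewrite /conj_op opadj_mul -!opmulA. Qed.

Hypothesis unitG : forall j, unitary_op (G j).

Lemma layer_op_unitary l :
  opmul (layer_op l) (opadj (layer_op l)) = opid /\
  opmul (opadj (layer_op l)) (layer_op l) = opid.
Proof.
elim: l => [|j l [IH1 IH2]] /=; first by rewrite opadj1 opmul1.
rewrite !opadj_mul; split.
  by rewrite -opmulA [opmul (layer_op l) _]opmulA IH1 op1mul unitary_opr.
by rewrite -opmulA [opmul (opadj (G j)) _]opmulA unitary_opl // op1mul.
Qed.

Hypothesis localG : forall j, local_op (S j) (G j).
Hypothesis disjS : forall j j', j != j' -> [disjoint S j & S j'].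

(** Gates are absorbed one at a time. A gate disjoint from the current support commutes with the
    observable and cancels against its adjoint. Any other gate lies in [J] and joins the support;
    later gates are disjoint from it, so the alternative persists for them. *)
Lemma conj_layer_local l (Q J : {set 'I_N}) O : uniq l -> Q \subset J ->
    (forall j, j \in l -> S j \subset J \/ [disjoint S j & Q]) ->
  local_op Q O -> local_op J (conj_op (layer_op l) O).
Proof.
elim: l Q O => [|j l IH] Q O /=.
  by move=> _ QJ _ lO; rewrite /conj_op opadj1 op1mul opmul1; apply: local_op_sub lO.
move=> /andP[jl ul] QJ hl lO; rewrite conj_op_comp.
have hl' j' : j' \in l -> S j' \subset J \/ [disjoint S j' & Q].
  by move=> j'l; apply: hl; rewrite inE j'l orbT.
have [|SjQ] := hl j (mem_head _ _); last first.
  apply: IH hl' _ => //; rewrite /conj_op (_ : opmul O (G j) = opmul (G j) O).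
    by rewrite opmulA unitary_opl // op1mul.
  by symmetry; apply: local_op_comm SjQ _ lO; exact: localG.
move=> SjJ; apply: (IH (S j :|: (Q :|: S j))) => //.
- by rewrite !subUset SjJ QJ.
- move=> j' j'l; have [|dj'] := hl' j' j'l; first by left.
  right; have dSS : [disjoint S j' & S j].
    by apply: disjS; apply: contraNneq jl => <-.
  rewrite -setI_eq0 in dSS; rewrite -setI_eq0 in dj'.
  by rewrite -setI_eq0 !setIUr (eqP dSS) (eqP dj') !setU0.
apply: local_op_mul; first by apply: local_op_adj; exact: localG.
by apply: local_op_mul => //; exact: localG.
Qed.

End Layer.

(** Blocks are periodic; the margin [k] at both ends keeps a block that meets the window from
    wrapping around the chain. *)
Lemma block_sites k (B : {set 'I_N}) a b : block k B -> (k <= a)%N -> (b + k <= N)%N ->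
  B \subset sites (a - k) (b + k) \/ [disjoint B & sites a b].
Proof.
move=> [a0 [m [mk ->]]] ka bk.
case: (boolP [disjoint _ & _]) => [|/pred0Pn[i0 /=]]; first by right.
rewrite !inE => /andP[h0 /andP[ai ib]]; left; apply/subsetP => i; rewrite !inE => h.
have aN := ltn_ord a0; have iN := ltn_ord i; have i0N := ltn_ord i0.
have modE (x : 'I_N) : ((x + N - a0) %% N = if a0 <= x then x - a0 else x + N - a0)%N.
  have xN := ltn_ord x; case: leqP => ax.
    have -> : (x + N - a0 = x - a0 + N)%N by lia.
    by rewrite modnDr modn_small //; lia.
  by rewrite modn_small //; lia.
move: h0 h; rewrite !modE; case: ifP; case: ifP; lia.
Qed.

(** In the Heisenberg picture one layer widens each window by at most [k] on either side, which the
    larger margin allows for. *)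
Lemma layer_factorizing (x0 : config) k L v w : is_layer k L -> factorizing v w ->
  factorizing (apply_op L v) (w + k) /\ ev (apply_op L v) opid = ev v opid.
Proof.
move=> [n [S [G [blockS [actsG [unitG [disjS hL]]]]]]] fv.
have localG j : local_op (S j) (G j) by exact: local_of_acts_on.
(* A layer is given only by its action on states, which determines the operator. *)
have LE : L = layer_op G (enum 'I_n).
  by apply: apply_op_inj => u; rewrite hL apply_layer_op.
have [WW1 WW2] := layer_op_unitary unitG (enum 'I_n).
rewrite LE; split; last first.
  by rewrite ev_apply op1mul WW2.
move=> a b a' b' O O' wa bN wa' b'N bw lO lO'.
rewrite !ev_apply -!/(conj_op _ _) conj_op_mul //.
have loc x y O'' : (w + k <= x)%N -> (y + (w + k) <= N)%N -> local_op (sites x y) O'' ->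
    local_op (sites (x - k) (y + k)) (conj_op (layer_op G (enum 'I_n)) O'').
  move=> wx yN lO''.
  apply: (conj_layer_local unitG localG disjS (enum_uniq _) _ _ lO'').
    by apply/subsetP => i; rewrite !inE; lia.
  by move=> j _; apply: block_sites => //; lia.
apply: (fv _ _ _ _ _ _ _ _ _ _ _ (loc _ _ _ _ _ lO) (loc _ _ _ _ _ lO')); lia.
Qed.

Lemma circuit_factorizing (x0 : config) k T psi : circuit_state k T psi ->
  factorizing psi (T * k) /\ ev psi opid = 1.
Proof.
move=> [Ls [p [hL [pp ->]]]].
have f0 : factorizing p 0.
  move=> a b a' b' O O' _ _ _ _ bw; apply: ev_mul_product => //.
  by apply/pred0Pn => -[i /=]; rewrite !inE; lia.
have gen (l : seq 'I_T) v w : factorizing v w ->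
    factorizing (foldl (fun v t => apply_op (Ls t) v) v l) (w + size l * k) /\
    ev (foldl (fun v t => apply_op (Ls t) v) v l) opid = ev v opid.
  elim: l v w => [|t l IH] v w fv /=; first by rewrite addn0.
  have [f1 e1] := layer_factorizing x0 (hL t) fv.
  by have [f2 e2] := IH _ _ f1; rewrite mulSn addnA -e1.
have [f1 e1] := gen (enum 'I_T) p 0%N f0.
by rewrite size_enum_ord add0n in f1; split; rewrite // e1 product_state_norm.
Qed.

End Circuits.

(** * Expectation values in matrix product states *)

Lemma mxringZAl (K : comPzRingType) n (c : K) (M M' : 'M[K]_n) : c *: (M * M') = c *: M * M'.
Proof. exact: scalemxAl. Qed.

Lemma mxringZAr (K : comPzRingType) n (c : K) (M M' : 'M[K]_n) : c *: (M * M') = M * (c *: M').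
Proof. exact: scalemxAr. Qed.

Section TransferAdjoint.
Variables (R : realType) (D : nat).
Local Notation C := R[i].
Local Notation cj := (@conjc R).

Definition tens_swap (k : 'I_(D * D)) : 'I_(D * D) :=
  mxtens_index ((mxtens_unindex k).2, (mxtens_unindex k).1).

Lemma tens_swapK : involutive tens_swap.
Proof. by move=> k; case: (mxtens_indexP k) => i j; rewrite /tens_swap !mxtens_indexK. Qed.

(* Taking adjoints of operators acts on transfer matrices as this antilinear
   ring automorphism. *)
Definition tdag (M : 'M[C]_(D * D)) : 'M[C]_(D * D) :=
  \matrix_(k, l) cj (M (tens_swap k) (tens_swap l)).

Lemma tdagM M M' : tdag (M * M') = tdag M * tdag M'.
Proof.
apply/matrixP => k l; rewrite !mxE rmorph_sum /= (reindex_inj (inv_inj tens_swapK)).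
by apply: eq_bigr => m _; rewrite !mxE rmorphM.
Qed.

Lemma tdag1 : tdag 1 = 1.
Proof.
by apply/matrixP => k l; rewrite !mxE (inj_eq (inv_inj tens_swapK)) conjc_nat.
Qed.

Lemma tdag_prod (a b : nat) (F : nat -> 'M[C]_(D * D)) :
  tdag (\prod_(a <= i < b) F i) = \prod_(a <= i < b) tdag (F i).
Proof. by elim/big_rec2: _ => [|i x y _ <-]; rewrite ?tdag1 ?tdagM. Qed.

Lemma tdagD M M' : tdag (M + M') = tdag M + tdag M'.
Proof. by apply/matrixP => k l; rewrite !mxE rmorphD. Qed.

Lemma tdag0 : tdag 0 = 0.
Proof. by apply/matrixP => k l; rewrite !mxE conjc0. Qed.

Lemma tdag_sum (Q : finType) (F : Q -> 'M[C]_(D * D)) :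
  tdag (\sum_q F q) = \sum_q tdag (F q).
Proof. by elim/big_rec2: _ => [|i x y _ <-]; rewrite ?tdag0 ?tdagD. Qed.

Lemma tdagZ c M : tdag (c *: M) = cj c *: tdag M.
Proof. by apply/matrixP => k l; rewrite !mxE rmorphM. Qed.

Lemma tdag_tens (M M' : 'M[C]_D) : tdag (map_mx cj M *t M') = map_mx cj M' *t M.
Proof.
apply/matrixP => k l; case: (mxtens_indexP k) => i i'; case: (mxtens_indexP l) => j j'.
by rewrite mxE /tens_swap !mxtens_indexK !tensmxE !mxE rmorphM /= conjcK mulrC.
Qed.

Lemma tdagX M n : tdag (M ^+ n) = tdag M ^+ n.
Proof. by elim: n => [|n IH]; rewrite ?tdag1 // !exprS tdagM IH. Qed.

Lemma mxtrace_tens (M M' : 'M[C]_D) : \tr (M *t M') = \tr M * \tr M'.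
Proof.
rewrite /mxtrace sum_tens_index big_distrlr; apply: eq_bigr => i _.
by apply: eq_bigr => j _; rewrite tensmxE.
Qed.

End TransferAdjoint.

(** * Norm bounds by row and column sums *)

Section SchurBound.
Variables (R : realType) (N d : nat).
Local Notation C := R[i].
Local Notation op := (op R N d).
Local Notation state := (state R N d).

(* Schur test: such an operator has norm at most [K]. *)
Definition schur_bounded (K : R) (O : op) :=
  (forall x, \sum_y cabs (O x y) <= K) /\ (forall y, \sum_x cabs (O x y) <= K).

(** By [|v x| |v y| <= (|v x|^2 + |v y|^2) / 2]: row sums bound the first half, column sums the
    second. *)
Lemma schur_bounded_ev K O (v : state) : schur_bounded K O ->
  cabs (ev v O) <= K * \sum_x cabs (v x) ^+ 2.
Proof.
move=> [hr hc].
have amgm x y : cabs (v x) * cabs (v y) <= (cabs (v x) ^+ 2 + cabs (v y) ^+ 2) / 2.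
  have := sqr_ge0 (cabs (v x) - cabs (v y)); nra.
apply: le_trans (cabs_sum _ _ _) _.
apply: le_trans (_ : \sum_x \sum_y cabs (O x y) * ((cabs (v x) ^+ 2 + cabs (v y) ^+ 2) / 2) <= _).
  apply: ler_sum => x _; rewrite cabsM cabsJ /apply_op.
  apply: le_trans (ler_wpM2l (cabs_ge0 _) (cabs_sum _ _ _)) _.
  rewrite mulr_sumr; apply: ler_sum => y _; rewrite cabsM mulrCA.
  by rewrite ler_wpM2l ?cabs_ge0.
have hx : \sum_x \sum_y cabs (O x y) * (cabs (v x) ^+ 2 / 2) <= K * (\sum_x cabs (v x) ^+ 2) / 2.
  rewrite -mulrA mulr_suml mulr_sumr; apply: ler_sum => x _; rewrite -mulr_suml.
  by rewrite ler_wpM2r // divr_ge0 // sqr_ge0.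
have hy : \sum_x \sum_y cabs (O x y) * (cabs (v y) ^+ 2 / 2) <= K * (\sum_x cabs (v x) ^+ 2) / 2.
  rewrite exchange_big -mulrA mulr_suml mulr_sumr; apply: ler_sum => x _; rewrite -mulr_suml.
  by rewrite ler_wpM2r // divr_ge0 // sqr_ge0.
under eq_bigr => x _ do (under eq_bigr => y _ do rewrite mulrDl mulrDr; rewrite big_split /=).
rewrite big_split /=; lra.
Qed.

Lemma schur_bounded_adj K O : schur_bounded K O -> schur_bounded K (opadj O).
Proof.
by move=> [hr hc]; split => x; under eq_bigr => y _ do rewrite cabsJ.
Qed.

Lemma schur_bounded_mul K K' O O' : 0 <= K -> 0 <= K' ->
  schur_bounded K O -> schur_bounded K' O' -> schur_bounded (K * K') (opmul O O').
Proof.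
move=> K0 K'0 [hr hc] [hr' hc']; split => x.
  apply: le_trans (_ : \sum_z cabs (O x z) * K' <= _); last by rewrite -mulr_suml ler_wpM2r.
  apply: le_trans (_ : \sum_y \sum_z cabs (O x z) * cabs (O' z y) <= _).
    apply: ler_sum => y _; apply: le_trans (cabs_sum _ _ _) _.
    by apply: ler_sum => z _; rewrite cabsM.
  rewrite exchange_big; apply: ler_sum => z _; rewrite -mulr_sumr.
  by rewrite ler_wpM2l ?cabs_ge0.
apply: le_trans (_ : \sum_z K * cabs (O' z x) <= _); last by rewrite -mulr_sumr ler_wpM2l.
apply: le_trans (_ : \sum_y \sum_z cabs (O y z) * cabs (O' z x) <= _).
  apply: ler_sum => y _; apply: le_trans (cabs_sum _ _ _) _.
  by apply: ler_sum => z _; rewrite cabsM.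
rewrite exchange_big; apply: ler_sum => z _; rewrite -mulr_suml.
by rewrite ler_wpM2r ?cabs_ge0.
Qed.

Lemma schur_bounded_opsum (Q : finType) (c : Q -> C) (O : Q -> op) :
  (forall q, schur_bounded 1 (O q)) -> schur_bounded (\sum_q cabs (c q)) (opsum c O).
Proof.
move=> h; split => x.
  apply: le_trans (_ : \sum_y \sum_q cabs (c q) * cabs (O q x y) <= _).
    apply: ler_sum => y _; apply: le_trans (cabs_sum _ _ _) _.
    by apply: ler_sum => q _; rewrite cabsM.
  rewrite exchange_big; apply: ler_sum => q _; rewrite -mulr_sumr.
  by rewrite ler_piMr ?cabs_ge0 //; case: (h q).
apply: le_trans (_ : \sum_y \sum_q cabs (c q) * cabs (O q y x) <= _).
  apply: ler_sum => y _; apply: le_trans (cabs_sum _ _ _) _.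
  by apply: ler_sum => q _; rewrite cabsM.
rewrite exchange_big; apply: ler_sum => q _; rewrite -mulr_sumr.
by rewrite ler_piMr ?cabs_ge0 //; case: (h q).
Qed.

Lemma cabs_prod (F : 'I_N -> C) : cabs (\prod_j F j) = \prod_j cabs (F j).
Proof. by elim/big_rec2: _ => [|i x y _ <-]; rewrite ?cabs1 ?cabsM. Qed.

Lemma schur_bounded_pop (u : 'I_N -> site_op R d) :
    (forall j a, \sum_b cabs (u j a b) <= 1) -> (forall j b, \sum_a cabs (u j a b) <= 1) ->
  schur_bounded 1 (pop u).
Proof.
move=> hr hc; split => x.
  under eq_bigr => y _ do rewrite cabs_prod.
  rewrite -(bigA_distr_bigA (fun j b => cabs (u j (x j) b))).
  apply: prodr_ile1 => j _; rewrite hr andbT.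
  by apply: sumr_ge0 => b _; exact: cabs_ge0.
under eq_bigr => y _ do rewrite cabs_prod.
rewrite -(bigA_distr_bigA (fun j b => cabs (u j b (x j)))).
apply: prodr_ile1 => j _; rewrite hc andbT.
by apply: sumr_ge0 => b _; exact: cabs_ge0.
Qed.

End SchurBound.

Section MatrixProductExpectations.
Variables (R : realType) (d D : nat) (A : 'I_d -> 'M[R[i]]_D).
Local Notation C := R[i].
Local Notation cj := (@conjc R).
Local Notation E := (transfer A).
Local Notation site_op := (site_op R d).

Lemma site_transfer_adj (o : site_op) : site_transfer A (site_adj o) = tdag (site_transfer A o).
Proof.
rewrite /site_transfer tdag_sum exchange_big; apply: eq_bigr => a _.
by rewrite tdag_sum; apply: eq_bigr => b _; rewrite tdagZ tdag_tens.
Qed.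

Lemma tdag_transfer : tdag E = E.
Proof. by rewrite -site_transfer_id -site_transfer_adj site_adj1. Qed.

Lemma ev_pop_mps N (u : 'I_N -> site_op) :
  ev (mps_raw A N) (pop u) = \tr (\prod_j site_transfer A (u j)).
Proof.
rewrite -[\prod_j _]/(\big[mulmx/1%:M]_j _) site_transfer_words raddf_sum.
apply: eq_bigr => x _; rewrite [RHS]raddf_sum /apply_op [LHS]big_distrr /=; apply: eq_bigr => y _.
rewrite linearZ /= mxtrace_tens /pop /mps_raw -!/(word A _).
have -> : \tr (map_mx cj (word A x)) = cj (\tr (word A x)).
  by rewrite trace_map_mx.
ring.
Qed.

(* [M] is the transfer matrix of [O]: in the contraction of [O] with two copies of
   the matrix product state, the sites [a <= i < b] contribute the factor [M]. *)
Definition window_op N (a b : nat) (O : op R N d) (M : 'M[C]_(D * D)) :=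
  exists (Q : finType) (c : Q -> C) (u : Q -> nat -> site_op),
  [/\ forall q i, ~~ (a <= i < b)%N -> u q i = @site_id R d,
      O = opsum c (fun q => pop (fun j : 'I_N => u q j)) &
      M = \sum_q c q *: \prod_(a <= i < b) site_transfer A (u q i)].

Lemma window_op_local N a b O M : @window_op N a b O M -> local_op (sites N a b) O.
Proof.
move=> [Q [c [u [hu -> _]]]]; exists Q, c, (fun q j => u q (val j)); split => // q i.
by rewrite inE => /hu.
Qed.

Lemma prod_site_id (u : nat -> site_op) a b : (forall i, (a <= i < b)%N -> u i = @site_id R d) ->
  \prod_(a <= i < b) site_transfer A (u i) = E ^+ (b - a).
Proof.
move=> hu; rewrite -(prodr_const_nat a b); apply: eq_big_nat => i /hu ->.
exact: site_transfer_id.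
Qed.

(** The sites outside the window carry the identity and contribute powers of [E]. *)
Lemma ev_window_op N a b O M : (a <= b)%N -> (b <= N)%N -> @window_op N a b O M ->
  ev (mps_raw A N) O = \tr (E ^+ a * M * E ^+ (N - b)).
Proof.
move=> ab bN [Q [c [u [hu -> ->]]]].
rewrite ev_opsum mulr_sumr mulr_suml raddf_sum; apply: eq_bigr => q _.
rewrite -mxringZAr -mxringZAl /= linearZ /= ev_pop_mps; congr (_ * \tr _).
rewrite -(big_mkord xpredT (fun j => site_transfer A (u q j))).
rewrite (big_cat_nat (n := a)) ?(leq_trans ab) //= (big_cat_nat (n := b) (p := N)) //=.
rewrite mulrA (prod_site_id (a := 0)) ?subn0; last by move=> i ia; apply: hu; lia.
by rewrite [in X in _ * _ * X = _]prod_site_id // => i ib; apply: hu; lia.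
Qed.

Lemma window_op_mul N a b a' b' O M O' M' : (a <= b)%N -> (b <= a')%N -> (a' <= b')%N ->
  @window_op N a b O M -> @window_op N a' b' O' M' ->
  window_op a b' (opmul O O') (M * E ^+ (a' - b) * M').
Proof.
move=> ab ba' ab' [Q [c [u [hu -> ->]]]] [Q' [c' [u' [hu' -> ->]]]].
exists (Q * Q')%type, (fun q => c q.1 * c' q.2), (fun q i => site_mul (u q.1 i) (u' q.2 i)); split.
- by move=> q i h; rewrite hu ?hu' ?site_mul1 //; lia.
- by rewrite opsum_mul; congr opsum; apply: boolp.funext => q; rewrite pop_mul.
rewrite !mulr_suml -(pair_bigA _ (fun i j => (c i * c' j) *:
  \prod_(a <= k < b') site_transfer A (site_mul (u i k) (u' j k)))) /=.
apply: eq_bigr => q _; rewrite mulr_sumr; apply: eq_bigr => q' _.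
rewrite -!mxringZAl -mxringZAr scalerA; congr (_ *: _).
rewrite [RHS](big_cat_nat ab (leq_trans ba' ab')) /= [X in _ = _ * X](big_cat_nat ba' ab') /=.
rewrite mulrA; congr (_ * _ * _).
- by apply: eq_big_nat => i h; rewrite (hu' q') ?site_mul1 //; lia.
- by rewrite prod_site_id // => i h; rewrite hu ?hu' ?site_mul1 //; lia.
by apply: eq_big_nat => i h; rewrite (hu q) ?site_1mul //; lia.
Qed.

Lemma window_op_adj N a b O M : @window_op N a b O M -> window_op a b (opadj O) (tdag M).
Proof.
move=> [Q [c [u [hu -> ->]]]].
exists Q, (fun q => cj (c q)), (fun q i => site_adj (u q i)); split.
- by move=> q i h; rewrite hu // site_adj1.
- by rewrite opsum_adj; congr opsum; apply: boolp.funext => q; rewrite pop_adj.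
rewrite tdag_sum; apply: eq_bigr => q _; rewrite tdagZ tdag_prod.
by congr (_ *: _); apply: eq_bigr => i _; rewrite site_transfer_adj.
Qed.

Definition opscale N (c : C) (O : op R N d) : op R N d := fun x y => c * O x y.

Lemma window_op_scale N a b c O M : @window_op N a b O M -> window_op a b (opscale c O) (c *: M).
Proof.
move=> [Q [c' [u [hu -> ->]]]]; exists Q, (fun q => c * c' q), u; split => //.
  apply: op_ext => x y; rewrite /opscale /opsum big_distrr /=; apply: eq_bigr => q _.
  by rewrite mulrA.
by rewrite scaler_sumr; apply: eq_bigr => q _; rewrite scalerA.
Qed.

Definition site_unit (a b : 'I_d) : site_op := fun x y => ((x == a) && (y == b))%:R.

Lemma site_transfer_unit a b : site_transfer A (site_unit a b) = map_mx cj (A a) *t A b.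
Proof.
rewrite /site_transfer (bigD1 a) //= [X in _ + X]big1 ?addr0 => [|i ia]; last first.
  by rewrite big1 // => j _; rewrite /site_unit (negPf ia) scale0r.
rewrite (bigD1 b) //= big1 ?addr0 => [|i ib]; first by rewrite /site_unit !eqxx scale1r.
by rewrite /site_unit (negPf ib) andbF scale0r.
Qed.

(** The matrix unit between two words, site by site. The test [s <= i] guards the truncated
    subtraction, which would send every [i < s] to 0. *)
Definition window_unit l s (a b : config l d) (i : nat) : site_op :=
  if (s <= i)%N then
    if insub (i - s)%N is Some j then site_unit (a j) (b j) else @site_id R d
  else @site_id R d.

Lemma sum_cabs_eq (b : 'I_d) (e : bool) (P : pred 'I_d) : P =1 pred1 b ->
  \sum_y cabs ((e && P y)%:R : C) <= 1.
Proof.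
move=> hP; case: e => /=; last by rewrite big1 ?ler01 // => y _; rewrite cabs0.
rewrite (bigD1 b) //= hP /= eqxx cabs1 big1 ?addr0 // => y yb.
by rewrite hP /= (negPf yb) cabs0.
Qed.

Lemma window_unit_bounded l s (a b : config l d) i :
  (forall x, \sum_y cabs (window_unit s a b i x y) <= 1) /\
  (forall y, \sum_x cabs (window_unit s a b i x y) <= 1).
Proof.
have id1 : (forall x, \sum_y cabs (@site_id R d x y) <= 1) /\
  (forall y, \sum_x cabs (@site_id R d x y) <= 1).
  by split => x; apply: (@sum_cabs_eq x true) => y //=; rewrite eq_sym.
rewrite /window_unit; case: ifP => // _; case: insubP => // j _ _; split => x.
  exact: sum_cabs_eq.
rewrite /site_unit; under eq_bigr do rewrite andbC.
exact: sum_cabs_eq.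
Qed.

(** The bound is the total modulus of the coefficients [X], which depends neither on the length of
    the chain nor on the position. *)
Lemma window_op_exists l (X : config l d -> config l d -> C) (M : 'M[C]_(D * D)) :
    \sum_a \sum_b X a b *: (map_mx cj (word A a) *t word A b) = M ->
  exists2 K, 0 <= K & forall N s, exists2 O : op R N d, window_op s (s + l) O M & schur_bounded K O.
Proof.
move=> hM; pose c (q : config l d * config l d) := X q.1 q.2.
exists (\sum_q cabs (c q)); first by apply: sumr_ge0 => q _; exact: cabs_ge0.
move=> N s; exists (opsum c (fun q => pop (fun j : 'I_N => window_unit s q.1 q.2 j))).
  exists _, c, (fun q => window_unit s q.1 q.2); split => //.
    move=> q i h; rewrite /window_unit; case: leqP => // si; case: insubP => // j jl _.
    by lia.
  rewrite -hM pair_bigA; apply: eq_bigr => q _; congr (_ *: _).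
  rewrite -{1}[s]add0n big_addn addKn big_mkord.
  rewrite /word map_big_mulmx -tens_big_mulmx; apply: eq_bigr => i _.
  rewrite -site_transfer_unit; congr site_transfer.
  by rewrite /window_unit leq_addl addnK insubT //= => il; congr site_unit; congr (fun_of_fin _ _); apply: val_inj.
apply: schur_bounded_opsum => q; apply: schur_bounded_pop => j.
  exact: (window_unit_bounded s q.1 q.2 j).1.
exact: (window_unit_bounded s q.1 q.2 j).2.
Qed.

End MatrixProductExpectations.

(** * The overlap bound *)

Section OverlapBound.
Variables (R : realType) (N d : nat).
Local Notation C := R[i].
Local Notation cj := (@conjc R).
Local Notation op := (op R N d).
Local Notation state := (state R N d).
Local Notation opid := (@opid R N d).
Implicit Types (v w : state) (O : op).

Definition nsq v : R := \sum_x cabs (v x) ^+ 2.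

Lemma dot_nsq v : dot v v = (nsq v)%:C%C.
Proof. by rewrite /nsq rmorph_sum; apply: eq_bigr => x _; rewrite mulJc. Qed.

Lemma nsq_ge0 v : 0 <= nsq v.
Proof. by apply: sumr_ge0 => x _; exact: sqr_ge0. Qed.

Lemma nsq_unit v : ev v opid = 1 -> nsq v = 1.
Proof. by rewrite ev_opid dot_nsq => -[]. Qed.

Lemma dotC v w : dot v w = cj (dot w v).
Proof.
by rewrite /dot rmorph_sum; apply: eq_bigr => x _; rewrite rmorphM /= conjcK mulrC.
Qed.

Lemma ev_adj v O : ev v (opadj O) = cj (ev v O).
Proof. by rewrite /ev dot_apply_op opadjK dotC. Qed.

Lemma dot_sub v u u' c c' : dot v v = 1 ->
  dot (fun x => u x - c * v x) (fun x => u' x - c' * v x) =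
  dot u u' - c' * dot u v - cj c * dot v u' + cj c * c'.
Proof.
move=> v1; rewrite -[cj c * c']mulr1 -v1 /dot !mulr_sumr -!sumrB -big_split.
by apply: eq_bigr => x _; rewrite rmorphB rmorphM /=; ring.
Qed.

(** Nonnegativity of the squared norm of [w - c v], with [c] the overlap. *)
Lemma cauchy_schwarz v w : dot v v = 1 -> cabs (dot v w) ^+ 2 <= nsq w.
Proof.
move=> v1; set c := dot v w.
have := dot_sub w w c c v1; rewrite !dot_nsq (dotC w) -/c.
have -> : (nsq w)%:C%C - c * cj c - cj c * c + cj c * c = (nsq w - cabs c ^+ 2)%:C%C.
  by rewrite rmorphB /= -mulJc; ring.
by move=> /complexI h; rewrite -subr_ge0 -h nsq_ge0.
Qed.

(** Its squared norm is the variance of [sum_j P_j] in the state [v]. *)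
Definition fluctuation n (P : 'I_n -> op) v : state :=
  fun x => \sum_j (apply_op (P j) v x - ev v (P j) * v x).

(** The squared norm is a sum of covariances: [n] diagonal ones and at most [n^2] others. *)
Lemma nsq_fluctuation n (P : 'I_n -> op) v (K eta : R) : ev v opid = 1 -> 0 <= eta ->
    (forall j, cabs (ev v (opmul (opadj (P j)) (P j))) <= K) ->
    (forall j j', j != j' ->
       cabs (ev v (opmul (opadj (P j)) (P j')) - cj (ev v (P j)) * ev v (P j')) <= eta) ->
  nsq (fluctuation P v) <= n%:R * K + n%:R ^+ 2 * eta.
Proof.
move=> v1 eta0 hd ho; have dv1 : dot v v = 1 by rewrite -ev_opid.
have gram : dot (fluctuation P v) (fluctuation P v) =
    \sum_j \sum_j' (ev v (opmul (opadj (P j)) (P j')) - cj (ev v (P j)) * ev v (P j')).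
  rewrite /dot /fluctuation.
  under eq_bigr => x _ do rewrite rmorph_sum big_distrlr /=.
  rewrite exchange_big; apply: eq_bigr => j _.
  rewrite exchange_big; apply: eq_bigr => j' _.
  etransitivity; first exact: (dot_sub (apply_op (P j) v) (apply_op (P j') v) (ev v (P j)) (ev v (P j')) dv1).
  rewrite [dot (apply_op (P j) v) v]dotC -!/(ev _ _).
  have -> : dot (apply_op (P j) v) (apply_op (P j') v) = ev v (opmul (opadj (P j)) (P j')).
    by rewrite /ev apply_op_mul [RHS]dot_apply_op opadjK.
  ring.
have -> : nsq (fluctuation P v) = complex.Re (dot (fluctuation P v) (fluctuation P v)).
  by rewrite dot_nsq.
rewrite gram raddf_sum.
apply: le_trans (_ : \sum_(j < n) (K + n%:R * eta) <= _); last first.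
  by rewrite sumr_const card_ord -[X in X <= _]mulr_natl mulrDr expr2 mulrA.
apply: ler_sum => j _; rewrite raddf_sum (bigD1 j) //= lerD //.
  rewrite raddfB mulJc /= lerBlDr; apply: le_trans (le_trans (Re_le_cabs _) (hd j)) _.
  by rewrite lerDl sqr_ge0.
apply: le_trans (_ : \sum_(j' < n | j' != j) eta <= _).
  apply: ler_sum => j' jj'; apply: le_trans (Re_le_cabs _) _.
  by apply: ho; rewrite eq_sym.
rewrite sumr_const -[X in X <= _]mulr_natl ler_wpM2r // ler_nat.
by rewrite -[X in (_ <= X)%N](card_ord n) max_card.
Qed.

(** [<psi| sum_j O_j |phi>] equals the sum of the means in either state times the overlap, plus a
    fluctuation of that state. Both fluctuations have norm at most [B], and the differences of
    means, real and at least [delta], add up. *)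
Lemma overlap_bound n (O : 'I_n -> op) phi psi (K eta delta B : R) :
    ev phi opid = 1 -> ev psi opid = 1 -> 0 <= eta -> 0 <= B ->
    (forall j, cabs (ev phi (opmul (opadj (O j)) (O j))) <= K) ->
    (forall j, cabs (ev psi (opmul (O j) (opadj (O j)))) <= K) ->
    (forall j j', j != j' ->
       cabs (ev phi (opmul (opadj (O j)) (O j')) - cj (ev phi (O j)) * ev phi (O j')) <= eta) ->
    (forall j j', j != j' ->
       ev psi (opmul (O j) (opadj (O j'))) = ev psi (O j) * ev psi (opadj (O j'))) ->
    (forall j, exists2 r, delta <= r & ev phi (O j) - ev psi (O j) = r%:C%C) ->
    n%:R * K + n%:R ^+ 2 * eta <= B ^+ 2 ->
  n%:R * delta * cabs (dot phi psi) <= 2 * B.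
Proof.
move=> phi1 psi1 eta0 B0 hphi hpsi ophi opsi hr hB.
have dphi : dot phi phi = 1 by rewrite -ev_opid.
have dpsi : dot psi psi = 1 by rewrite -ev_opid.
(* On the side of [psi] the operators act to the left, hence the adjoints. *)
pose F := fluctuation O phi; pose G := fluctuation (fun j => opadj (O j)) psi.
have F_le : cabs (dot psi F) <= B.
  rewrite -(ler_pXn2r (_ : 0 < 2)%N) ?nnegrE ?cabs_ge0 //.
  apply: le_trans (cauchy_schwarz _ dpsi) _; apply: le_trans hB.
  exact: nsq_fluctuation.
have G_le : cabs (dot phi G) <= B.
  rewrite -(ler_pXn2r (_ : 0 < 2)%N) ?nnegrE ?cabs_ge0 //.
  apply: le_trans (cauchy_schwarz _ dphi) _; apply: le_trans hB.
  apply: nsq_fluctuation => // [j|j j' jj']; rewrite opadjK //.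
  by rewrite opsi // [ev psi (opadj (O j))]ev_adj conjcK subrr cabs0.
have key : \sum_j (ev phi (O j) - ev psi (O j)) * dot psi phi = cj (dot phi G) - dot psi F.
  rewrite -dotC /dot /F /G /fluctuation.
  under [X in X - _]eq_bigr => x _ do rewrite rmorph_sum big_distrl /=.
  under [X in _ - X]eq_bigr => x _ do rewrite big_distrr /=.
  rewrite exchange_big [X in _ - X]exchange_big -sumrB; apply: eq_bigr => j _ /=.
  have e1 : \sum_x cj (apply_op (opadj (O j)) psi x - ev psi (opadj (O j)) * psi x) * phi x =
      dot psi (apply_op (O j) phi) - ev psi (O j) * dot psi phi.
    rewrite dot_apply_op /dot mulr_sumr -sumrB; apply: eq_bigr => x _.
    by rewrite rmorphB rmorphM /= ev_adj conjcK; ring.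
  have e2 : \sum_x cj (psi x) * (apply_op (O j) phi x - ev phi (O j) * phi x) =
      dot psi (apply_op (O j) phi) - ev phi (O j) * dot psi phi.
    rewrite /dot mulr_sumr -sumrB; apply: eq_bigr => x _; ring.
  rewrite e1 e2 /dot; ring.
have cdot : cabs (dot phi psi) = cabs (dot psi phi) by rewrite dotC cabsJ.
have := congr1 (@cabs R) key; rewrite -mulr_suml cabsM -cdot => h.
apply: le_trans (_ : cabs (\sum_j (ev phi (O j) - ev psi (O j))) * cabs (dot phi psi) <= _).
  rewrite ler_wpM2r ?cabs_ge0 //; apply: le_trans (Re_le_cabs _).
  rewrite raddf_sum; apply: le_trans (_ : \sum_(j < n) delta <= _).
    by rewrite sumr_const card_ord mulr_natl.
  by apply: ler_sum => j _; have [r dr ->] := hr j.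
rewrite h; apply: le_trans (cabsB _ _) _; rewrite cabsJ; lra.
Qed.

End OverlapBound.

(** * The number of blocks that fit into the chain *)

Section BlockCount.
Variable R : realType.

(** With [y = N^(1/4)], the growth condition gives both [T N <= y] and
    [kap ^- (4 * (T N * k)) <= y]. About [|Cst| y] blocks, each of length of order [y], then occupy
    at most [H y^2 <= y^3 <= N] sites, the offset included. *)
Lemma block_count (kap Cst : R) (k l p0 : nat) (T : nat -> nat) :
    0 < kap -> kap < 1 -> little_o_log R T ->
  exists N0 : nat, forall N, (N0 < N)%N -> exists n : nat,
    (4 * (T N * k) + p0 + n * (2 * l + 4 * (T N * k)) <= N)%N /\
    Cst < n%:R * kap ^+ (4 * (T N * k)).
Proof.
move=> kap0 kap1 hT.
(* The rate for which [kap ^+ (4 * (T N * k)) = expR (- (be * T N))]. *)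
pose be : R := (4 * k)%N%:R * - ln kap.
have be0 : 0 <= be by rewrite mulr_ge0 // oppr_ge0 ln_le0 // ltW.
have b10 : 0 < 4 * (be + 1) by lra.
(* This yields [(be + 1) T <= ln N / 4]: the summand [be] pays for the power of [kap], the summand 1
   for [T] itself. *)
have ib0 : 0 < (4 * (be + 1))^-1 by rewrite invr_gt0.
have [M hM] := hT _ ib0.
pose H : R := (4 * k)%N%:R + p0%:R + (`|Cst| + 1) * (2 * l + 4 * k)%N%:R.
have H0 : 0 <= H by rewrite !addr_ge0 // mulr_ge0 // addr_ge0.
have [M' hM'] : exists M' : nat, (H + 1) ^+ 4 < M'%:R.
  by exists (Num.bound ((H + 1) ^+ 4)); rewrite archi_boundP // exprn_ge0 // addr_ge0.
exists (maxn M M') => N; rewrite gtn_max => /andP[MN M'N].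
have N0 : 0 < N%:R :> R by rewrite ltr0n; case: (N) MN.
pose y : R := expR (ln N%:R / 4).
have y0 : 0 < y by exact: expR_gt0.
have y4 : y ^+ 4 = N%:R.
  by rewrite /y -expRM_natr divfK ?pnatr_eq0 // lnK.
have yH : H + 1 <= y.
  rewrite -(ler_pXn2r (_ : 0 < 4)%N) ?nnegrE ?(ltW y0) //; last by lra.
  by rewrite y4; apply: le_trans (ltW hM') _; rewrite ler_nat ltnW.
have TN : (be + 1) * (T N)%:R <= ln N%:R / 4.
  have := hM N MN; rewrite mulrC ler_pdivlMr //; lra.
have T0 : 0 <= (T N)%:R :> R by [].
have bT0 : 0 <= be * (T N)%:R by rewrite mulr_ge0.
rewrite mulrDl mul1r in TN.
have Ty : (T N)%:R <= y.
  apply: le_trans (_ : expR (T N)%:R <= _).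
    by apply: le_trans (expR_ge1Dx _); rewrite lerDr.
  by rewrite ler_expR; apply: le_trans _ TN; rewrite lerDr.
have kapy : 1 <= y * kap ^+ (4 * (T N * k)).
  have -> : kap ^+ (4 * (T N * k)) = expR (- (be * (T N)%:R)).
    rewrite -{1}(lnK (_ : kap \is Num.pos)) // -expRM_natl; congr expR.
    rewrite /be !natrM; ring.
  by rewrite /y -expRD -[X in X <= _]expR0 ler_expR subr_ge0; apply: le_trans _ TN; rewrite lerDl.
pose n := (Num.truncn (`|Cst| * y)).+1.
have Cy0 : 0 <= `|Cst| * y by rewrite mulr_ge0 // ltW.
have n_gt : `|Cst| * y < n%:R by rewrite /n truncnS_gt.
have n_le : n%:R <= `|Cst| * y + 1 by rewrite /n -natr1 lerD2r truncn_le.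
exists n; split; last first.
  apply: le_lt_trans (ler_norm _) _; have c0 := normr_ge0 Cst.
  have q0 : 0 < kap ^+ (4 * (T N * k)) by rewrite exprn_gt0.
  nra.
have e1 : (4 * (T N * k) + p0 + n * (2 * l + 4 * (T N * k)))%N%:R =
    4%:R * ((T N)%:R * k%:R) + p0%:R + n%:R * (2%:R * l%:R + 4%:R * ((T N)%:R * k%:R)) :> R.
  by rewrite -!(natrM, natrD).
have HE : H = 4%:R * k%:R + p0%:R + (`|Cst| + 1) * (2%:R * l%:R + 4%:R * k%:R).
  by rewrite /H -!(natrM, natrD).
rewrite -(ler_nat R) -y4 e1.
have c0 := normr_ge0 Cst.
have k0 : 0 <= k%:R :> R by []. have l0 : 0 <= l%:R :> R by [].
have p00 : 0 <= p0%:R :> R by [].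
rewrite HE in H0 yH.
have y1 : 1 <= y by lra.
set t := (T N)%:R in Ty T0 *; set kk := k%:R in k0 H0 yH *; set ll := l%:R in l0 H0 yH *.
set c := `|Cst| in c0 n_gt n_le Cy0 H0 yH *; set nn := n%:R in n_gt n_le *; set p := p0%:R in p00 H0 yH *.
have tk : t * kk <= y * kk by rewrite ler_wpM2r.
have w1 : 2%:R * ll + 4%:R * (t * kk) <= (2%:R * ll + 4%:R * kk) * y.
  have : ll <= ll * y by rewrite ler_peMr.
  lra.
have w0 : 0 <= 2%:R * ll + 4%:R * (t * kk) by rewrite addr_ge0 ?mulr_ge0.
have nb : nn <= (c + 1) * y by rewrite mulrDl mul1r; lra.
have nn0 : 0 <= nn by [].
have s1 : nn * (2%:R * ll + 4%:R * (t * kk)) <= (c + 1) * y * ((2%:R * ll + 4%:R * kk) * y).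
  by rewrite ler_pM.
have yy : y <= y * y by rewrite ler_peMr // ltW.
have s2 : 4%:R * (t * kk) + p <= (4%:R * kk + p) * (y * y).
  have a1 : y * kk <= y * y * kk by rewrite ler_wpM2r.
  have a2 : p <= p * (y * y) by rewrite ler_peMr //; lra.
  lra.
have s3 : (4%:R * kk + p + (c + 1) * (2%:R * ll + 4%:R * kk)) * (y * y) <= y * (y * y).
  by rewrite ler_wpM2r ?mulr_ge0 ?ltW //; lra.
have s4 : y * (y * y) <= y ^+ 4.
  rewrite (_ : y ^+ 4 = (y * y) * (y * y)); last by rewrite !exprS expr0; ring.
  by rewrite ler_wpM2r // mulr_ge0 // ltW.
lra.
Qed.

End BlockCount.

(** * Means and correlations of the block operators in the matrix product state *)

Section TransferSpectrum.
Variables (R : realType) (d D : nat) (A : 'I_d -> 'M[R[i]]_D).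
Local Notation C := R[i].
Local Notation cj := (@conjc R).
Local Notation E := (transfer A).

(* [u v0] is the projection onto the leading eigenspace; [w] is a left eigenvector
   of the subleading eigenvalue and [z] is dual to it. *)
Record spectral_data (lam : C) (u z : 'cV[C]_(D * D)) (v0 w : 'rV[C]_(D * D)) (K rho : R) := {
  sd_lam0 : 0 < cabs lam;
  sd_lam1 : cabs lam < 1;
  sd_u : E *m u = u;
  sd_v0 : v0 *m E = v0;
  sd_v0u : v0 *m u = 1%:M;
  sd_w : w *m E = lam *: w;
  sd_wu : w *m u = 0;
  sd_wz : w *m z = 1%:M;
  sd_v0z : v0 *m z = 0;
  sd_rho0 : 0 < rho;
  sd_rho1 : rho < 1;
  sd_decay : forall m i j, cabs ((E ^+ m - u *m v0) i j) <= K * rho ^+ m }.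

Lemma spectral_data_exists xi : normal_tensor A -> corr_length A xi -> 0 < xi ->
  exists lam u z v0 w K rho, spectral_data lam u z v0 w K rho.
Proof.
move=> [_ [root1 _]] [lam [[rootq hq] ->]]; rewrite oppr_gt0 invr_lt0 => ln_lt0'.
(* By convention [ln 0 = 0], which would make [xi] zero; hence [lam] is not 0. *)
have lam0 : 0 < cabs lam.
  rewrite lt_neqAle cabs_ge0 andbT eq_sym; apply/eqP => l0.
  by move: ln_lt0'; rewrite l0 ln0 // ltxx.
have lam1 : cabs lam < 1.
  by rewrite ltNge; apply/negP => /ln_ge0; rewrite leNgt ln_lt0'.
have [u [v0 [Eu vE vu [K [rho [K0 rho0 rho1 hK]]]]]] := spectral_projection root1 hq lam1.
have rootE : root (char_poly E) lam.
  by rewrite -(divpK (_ : 'X - 1%:P %| char_poly E)) ?dvdp_XsubCl // rootM rootq.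
have /eigenvalueP[w wE w0] : eigenvalue E lam by rewrite eigenvalue_root_char.
have wu : w *m u = 0.
  have : (1 - lam) *: (w *m u) = 0.
    by rewrite scalerBl scale1r scalemxAl -wE -mulmxA Eu subrr.
  move/eqP; rewrite scaler_eq0 subr_eq0 => /orP[/eqP l1|/eqP //].
  by move: lam1; rewrite -l1 cabs1 ltxx.
have [j wj] : exists j, w 0 j != 0.
  by have /rV0Pn := w0.
pose z0 : 'cV[C]_(D * D) := (w 0 j)^-1 *: delta_mx j 0.
have wz0 : w *m z0 = 1%:M.
  apply/matrixP => a b; rewrite !ord1 -scalemxAr mxE mxE (bigD1 j) //= big1 ?addr0 => [|i ij].
    by rewrite !mxE !eqxx mulr1 mulVf.
  by rewrite !mxE (negPf ij) mulr0.
(* Removing the component along [u] makes [v0] vanish on it and keeps its pairing with [w], since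
   [w u = 0]. *)
exists lam, u, (z0 - u *m (v0 *m z0)), v0, w, K, rho; split => //.
  by rewrite mulmxBr (mulmxA w) wu mul0mx subr0.
by rewrite mulmxBr (mulmxA v0) vu mul1mx subrr.
Qed.

Variables (lam : C) (u z : 'cV[C]_(D * D)) (v0 w : 'rV[C]_(D * D)) (K rho : R).
Hypothesis sd : spectral_data lam u z v0 w K rho.
Local Notation P := (u *m v0).
Local Notation kap := (cabs lam).

(** For [D = 0] the equation [v0 u = 1] fails; for [d = 0] the transfer matrix is zero, so
    [u = E u = 0]. *)
Lemma spectral_data_dim : (0 < D)%N /\ (0 < d)%N.
Proof.
have v1 := sd_v0u sd; have u1 := sd_u sd.
have nz : 1%:M != 0 :> 'M[C]_1 by exact: oner_neq0.
split; rewrite lt0n; apply/negP => /eqP h0; case/eqP: nz.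
  rewrite -v1; apply/matrixP => a b; rewrite mxE big1 ?mxE // => k _.
    by exfalso; case: k => k; rewrite h0.
rewrite -v1 -u1 (_ : E = 0) ?mul0mx ?mulmx0 //.
by rewrite /transfer big1 // => k _; exfalso; case: k => k; rewrite h0.
Qed.

Lemma expE_u m : E ^+ m *m u = u.
Proof. by elim: m => [|m IH]; rewrite ?mul1mx // exprS -mulmxA IH (sd_u sd). Qed.

Lemma v0_expE m : v0 *m E ^+ m = v0.
Proof. by elim: m => [|m IH]; rewrite ?mulmx1 // exprS mulmxA (sd_v0 sd) IH. Qed.

Lemma w_expE m : w *m E ^+ m = lam ^+ m *: w.
Proof.
elim: m => [|m IH]; first by rewrite mulmx1 scale1r.
by rewrite exprS mulmxA (sd_w sd) -scalemxAl IH scalerA -exprS.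
Qed.

Lemma mxtrace_P : \tr P = 1.
Proof. by rewrite mxtrace_mulC (sd_v0u sd) mxtrace1. Qed.

Lemma P_idem : P *m P = P.
Proof. by rewrite mulmxA -[u *m v0 *m u]mulmxA (sd_v0u sd) mulmx1. Qed.

Lemma small_eq0 (c : C) (K' : R) : (forall m, cabs c <= K' * rho ^+ m) -> c = 0.
Proof.
move=> h; apply/eqP; rewrite -cabs_eq0; apply/negPn/negP => c0.
have cpos : 0 < cabs c by rewrite lt_neqAle cabs_ge0 eq_sym c0.
have [M hM] := expr_small K' (sd_rho0 sd) (sd_rho1 sd) cpos.
by have := le_lt_trans (h M) (hM M (leqnn M)); rewrite ltxx.
Qed.

(** [P] is the limit of the powers of [E], all of which [tdag] fixes. *)
Lemma tdag_P : tdag P = P.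
Proof.
apply/matrixP => k l; apply/eqP; rewrite -subr_eq0; apply/eqP.
apply: (@small_eq0 _ (K + K)) => m.
have h1 := sd_decay sd m k l.
have h2 := sd_decay sd m (tens_swap k) (tens_swap l).
have Ekl : (E ^+ m) k l = cj ((E ^+ m) (tens_swap k) (tens_swap l)).
  by rewrite -{1}(tdag_transfer A) -tdagX mxE.
have -> : (tdag P) k l - P k l = (E ^+ m - P) k l - cj ((E ^+ m - P) (tens_swap k) (tens_swap l)).
  rewrite [(E ^+ m - P) k l]mxE [(E ^+ m - P) (tens_swap k) _]mxE [tdag P k l]mxE Ekl.
  rewrite [(- P) k l]mxE [(- P) _ _]mxE rmorphB /=; ring.
apply: le_trans (cabsB _ _) _; rewrite cabsJ mulrDl; exact: lerD.
Qed.

Lemma mxtrace_expE_cvg N : cabs (\tr (E ^+ N) - 1) <= (D * D)%N%:R * K * rho ^+ N.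
Proof.
have -> : \tr (E ^+ N) - 1 = \sum_k (E ^+ N - P) k k.
  by rewrite -mxtrace_P -raddfB.
apply: le_trans (cabs_sum _ _ _) _.
apply: le_trans (ler_sum _ (fun k _ => sd_decay sd N k k)) _.
by rewrite sumr_const card_ord -[X in X <= _]mulr_natl mulrA.
Qed.

(** Between the windows [E] fixes [u]. The transfer matrices on the rest of the ring, [N - b'] after
    the second window and [a] before the first, meet [w] by cyclicity of the trace and give the
    power of [lam]. *)
Lemma corr_right_X N a b a' b' O O' (M : 'M[C]_(D * D)) al :
    (a <= b)%N -> (b <= a')%N -> (a' <= b')%N -> (b' <= N)%N ->
    @window_op _ _ _ A N a b O M -> @window_op _ _ _ A N a' b' O' (al *: (u *m w)) ->
  ev (mps_raw A N) (opmul (opadj O) O') =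
  al * lam ^+ (N - b' + a) * \tr (tdag M *m (u *m w)).
Proof.
move=> ab ba' ab' bN hO hO'.
have hOO := window_op_mul ab ba' ab' (window_op_adj hO) hO'.
have ab2 : (a <= b')%N by lia.
etransitivity; first exact: (ev_window_op ab2 bN hOO).
transitivity (\tr (E ^+ a *m (tdag M *m E ^+ (a' - b) *m (al *: (u *m w))) *m E ^+ (N - b'))) => //.
rewrite -!scalemxAr -!scalemxAl !linearZ /= -[RHS]mulrA; congr (_ * _).
rewrite -!mulmxA w_expE !(mulmxA (E ^+ (a' - b))) expE_u -!scalemxAr linearZ /= exprD -mulrA.
congr (_ * _); rewrite !mulmxA -!mulmxA mxtrace_mulC -!mulmxA w_expE.
by rewrite -!scalemxAr linearZ.
Qed.

Lemma corr_right_P N a b a' b' O O' (M : 'M[C]_(D * D)) c :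
    (a <= b)%N -> (b <= a')%N -> (a' <= b')%N -> (b' <= N)%N ->
    @window_op _ _ _ A N a b O M -> @window_op _ _ _ A N a' b' O' (c *: P) ->
  ev (mps_raw A N) (opmul (opadj O) O') = c * \tr (tdag M *m P).
Proof.
move=> ab ba' ab' bN hO hO'.
have hOO := window_op_mul ab ba' ab' (window_op_adj hO) hO'.
have ab2 : (a <= b')%N by lia.
etransitivity; first exact: (ev_window_op ab2 bN hOO).
transitivity (\tr (E ^+ a *m (tdag M *m E ^+ (a' - b) *m (c *: P)) *m E ^+ (N - b'))) => //.
rewrite -!scalemxAr -!scalemxAl !linearZ /=; congr (_ * _).
rewrite -!mulmxA v0_expE !(mulmxA (E ^+ (a' - b))) expE_u.
by rewrite mxtrace_mulC -!mulmxA v0_expE.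
Qed.

Lemma ev_X N a b O al : (a <= b)%N -> (b <= N)%N ->
  @window_op _ _ _ A N a b O (al *: (u *m w)) -> ev (mps_raw A N) O = 0.
Proof.
move=> ab bN hO; rewrite (ev_window_op ab bN hO).
transitivity (\tr (E ^+ a *m (al *: (u *m w)) *m E ^+ (N - b))) => //.
rewrite -!scalemxAr -!scalemxAl linearZ /= -!mulmxA w_expE -!scalemxAr linearZ /=.
by rewrite mulmxA expE_u mxtrace_mulC (sd_wu sd) mxtrace0 !mulr0.
Qed.

Lemma ev_P N a b O c : (a <= b)%N -> (b <= N)%N ->
  @window_op _ _ _ A N a b O (c *: P) -> ev (mps_raw A N) O = c.
Proof.
move=> ab bN hO; rewrite (ev_window_op ab bN hO).
transitivity (\tr (E ^+ a *m (c *: P) *m E ^+ (N - b))) => //.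
rewrite -!scalemxAr -!scalemxAl linearZ /= -!mulmxA v0_expE mulmxA expE_u.
by rewrite mxtrace_P mulr1.
Qed.

Lemma ev_mps_raw_id N : ev (mps_raw A N) (@opid R N d) = \tr (E ^+ N).
Proof.
rewrite opid_pop ev_pop_mps -[\prod_j _]/(\big[mulmx/1%:M]_j _) big_mulmx_const.
by rewrite site_transfer_id.
Qed.

Lemma ev_scale N (v : state R N d) c (O : op R N d) :
  ev (fun x => v x * c) O = cj c * c * ev v O.
Proof.
rewrite /ev /dot mulr_sumr; apply: eq_bigr => x _.
have -> : apply_op O (fun x => v x * c) x = c * apply_op O v x.
  by rewrite /apply_op mulr_sumr; apply: eq_bigr => y _; ring.
by rewrite rmorphM /=; ring.
Qed.

(** The squared norm of the raw state is [\tr (E ^+ N)]. *)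
Lemma ev_mps N (O : op R N d) : \tr (E ^+ N) != 0 ->
  ev (mps A N) O = ev (mps_raw A N) O / \tr (E ^+ N).
Proof.
move=> t0; rewrite ev_scale mulrC; congr (_ * _).
have tE : \tr (E ^+ N) = (nsq (mps_raw A N))%:C%C by rewrite -ev_mps_raw_id ev_opid dot_nsq.
rewrite tE complexr0 -/(snorm _) conjc_inv conjc_real -invfM -rmorphM /= -expr2.
by rewrite sqr_sqrtr // nsq_ge0.
Qed.

(** The first alternative is [X] up to a phase. The second is [X Y] up to a phase, where the gap [r]
    between [X] and [Y] leaves the modulus [kap ^+ r]. *)
Definition block_op N r s e (O : op R N d) (M : 'M[C]_(D * D)) :=
  window_op A s e O M /\
  ((exists2 al, cabs al = 1 & M = al *: (u *m w)) \/
   (exists2 c, cabs c = kap ^+ r & M = c *: P)).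

Definition overlap_const : R := cabs (\tr (tdag (u *m w) *m (u *m w))).

(** Two operators of the first kind correlate only around the ring, through at least [p] transfer
    matrices. Operators of different kinds are uncorrelated because [w u = 0]. For two of the second
    kind, the normalizations [1 / tau] and [1 / |tau|^2] differ by a term of order [tau - 1]. *)
Lemma block_corr N r p s e s' e' (O O' : op R N d) M M' :
    (s <= e)%N -> (e <= s')%N -> (s' <= e')%N -> (e' <= N)%N -> (p <= s)%N ->
    1 / 2 <= cabs (\tr (E ^+ N)) ->
    block_op r s e O M -> block_op r s' e' O' M' ->
  cabs (ev (mps A N) (opmul (opadj O) O') - cj (ev (mps A N) O) * ev (mps A N) O') <=
  2 * overlap_const * kap ^+ p + 4 * kap ^+ (2 * r) * cabs (\tr (E ^+ N) - 1).
Proof.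
move=> se es' se' eN ps tau2 [hO hM] [hO' hM'].
have tau0 : \tr (E ^+ N) != 0 by rewrite -cabs_gt0; lra.
rewrite !ev_mps //; set tau := \tr _ in tau2 tau0 *.
have kap0 : 0 <= kap by exact: cabs_ge0.
have eN' : (e <= N)%N by lia.
have A0 : 0 <= 2 * overlap_const * kap ^+ p.
  by rewrite !mulr_ge0 ?exprn_ge0 ?cabs_ge0.
have B0 : 0 <= 4 * kap ^+ (2 * r) * cabs (tau - 1).
  by rewrite !mulr_ge0 ?exprn_ge0 ?cabs_ge0.
have tauV : (cabs tau)^-1 <= 2.
  by rewrite -[2]invrK lef_pV2 ?posrE; lra.
have uwP : (u *m w) *m P = 0.
  by rewrite mulmxA -[u *m w *m u]mulmxA (sd_wu sd) mulmx0 mul0mx.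
have Puw : \tr (P *m (u *m w)) = 0.
  by rewrite mxtrace_mulC uwP mxtrace0.
case: hM' => [] [c' c'1 M'E]; rewrite M'E in hO'.
  rewrite (corr_right_X se es' se' eN hO hO') (ev_X se' eN hO') mul0r mulr0 subr0.
  apply: le_trans (_ : 2 * overlap_const * kap ^+ p <= _); last by rewrite lerDl.
  rewrite !cabsM cabsV c'1 mul1r cabsX.
  have tr_le : cabs (\tr (tdag M *m (u *m w))) <= overlap_const.
    case: hM => [] [c c1 ->]; rewrite tdagZ -scalemxAl linearZ /= cabsM cabsJ c1.
      by rewrite mul1r.
    by rewrite tdag_P Puw cabs0 mulr0 cabs_ge0.
  have kap_le : kap ^+ (N - e' + s) <= kap ^+ p.
    by rewrite ler_wiXn2l // ?(ltW (sd_lam1 sd)) // (leq_trans ps) // leq_addl.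
  have -> : 2 * overlap_const * kap ^+ p = kap ^+ p * overlap_const * 2 by ring.
  by rewrite !ler_pM ?mulr_ge0 ?exprn_ge0 ?invr_ge0 ?cabs_ge0.
rewrite (corr_right_P se es' se' eN hO hO') (ev_P se' eN hO').
case: hM => [] [c c1 ME]; rewrite ME in hO *.
  rewrite (ev_X se eN' hO) mul0r conjc0 mul0r subr0 tdagZ -scalemxAl linearZ /=.
  rewrite -{1}tdag_P.
  have -> : tdag (u *m w) *m tdag P = 0.
    by rewrite -[_ *m _]tdagM -[u *m w * P]/(u *m w *m P) uwP tdag0.
  by rewrite mxtrace0 !mulr0 mul0r cabs0 addr_ge0.
rewrite (ev_P se eN' hO) tdagZ -scalemxAl linearZ /= tdag_P P_idem mxtrace_P mulr1.
apply: le_trans (_ : 4 * kap ^+ (2 * r) * cabs (tau - 1) <= _); last by rewrite lerDr.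
have -> : c' * cj c / tau - cj (c / tau) * (c' / tau) =
    c' * cj c * cj (tau - 1) * (cj tau * tau)^-1.
  have -> : cj (tau - 1) = cj tau - 1 by rewrite rmorphB rmorph1.
  have -> : cj (c / tau) = cj c / cj tau by rewrite rmorphM /= conjc_inv.
  by field; rewrite tau0 conjc_eq0 tau0.
rewrite !cabsM cabsV cabsM !cabsJ c1 c'1 invfM.
have -> : 4 * kap ^+ (2 * r) * cabs (tau - 1) = kap ^+ r * kap ^+ r * cabs (tau - 1) * (2 * 2).
  by rewrite mul2n -addnn exprD; ring.
by rewrite ler_wpM2l ?mulr_ge0 ?exprn_ge0 ?cabs_ge0 // ler_pM ?invr_ge0 ?cabs_ge0.
Qed.

End TransferSpectrum.

(** * An operator on one block that separates the two states *)

Section Blocks.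
Variables (R : realType) (d D : nat) (A : 'I_d -> 'M[R[i]]_D).
Local Notation C := R[i].
Local Notation cj := (@conjc R).
Local Notation E := (transfer A).
Variables (lam : C) (u z : 'cV[C]_(D * D)) (v0 w : 'rV[C]_(D * D)) (K0 rho : R).
Hypothesis sd : spectral_data A lam u z v0 w K0 rho.
Local Notation P := (u *m v0).
Local Notation kap := (cabs lam).

Lemma schur_bounded_scale N (K : R) c (O : op R N d) : cabs c = 1 ->
  schur_bounded K O -> schur_bounded K (opscale c O).
Proof.
move=> c1 [hr hc]; split => x.
  by under eq_bigr => y _ do rewrite cabsM c1 mul1r.
by under eq_bigr => y _ do rewrite cabsM c1 mul1r.
Qed.

Lemma schur_bounded_le N (K K' : R) (O : op R N d) : K <= K' ->
  schur_bounded K O -> schur_bounded K' O.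
Proof. by move=> KK' [hr hc]; split => x; apply: le_trans KK'. Qed.

Lemma ev_opscale N (v : state R N d) c (O : op R N d) : ev v (opscale c O) = c * ev v O.
Proof.
rewrite /ev /dot mulr_sumr; apply: eq_bigr => x _.
rewrite /apply_op mulrCA; congr (_ * _); rewrite mulr_sumr; apply: eq_bigr => y _.
by rewrite mulrA.
Qed.

Lemma transfer_XY r : (u *m w) *m E ^+ r *m (z *m v0) = lam ^+ r *: P.
Proof.
rewrite -(mulmxA u) (w_expE sd) -scalemxAr -scalemxAl; congr (_ *: _).
by rewrite -mulmxA (mulmxA w) (sd_wz sd) mul1mx.
Qed.

(* In the state [psi], [X] and [Y] are uncorrelated; in the matrix product state
   [X] has mean [0] and [X Y] has mean [lam ^+ r / tau].  So one of [X], [X Y]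
   tells the two states apart. *)
Lemma distinguishing_block N (psi : state R N d) (X Y : op R N d) K s l r :
    1 <= K -> (s + 2 * l + r <= N)%N ->
    1 / 2 <= cabs (\tr (E ^+ N)) -> cabs (\tr (E ^+ N)) <= 2 ->
    window_op A s (s + l) X (u *m w) ->
    window_op A (s + l + r) (s + l + r + l) Y (z *m v0) ->
    schur_bounded K X -> schur_bounded K Y -> nsq psi = 1 ->
    ev psi (opmul X Y) = ev psi X * ev psi Y ->
  exists O e M,
  [/\ block_op A lam u v0 w r s e O M, (s <= e <= s + 2 * l + r)%N, schur_bounded (K * K) O &
   exists2 g, kap ^+ r / (4 * K) <= g & ev (mps A N) O - ev psi O = g%:C%C].
Proof.
move=> K1 sN tau2 tau2' hX hY bX bY psi1 fXY.
have esE : (s + l + r + l = s + 2 * l + r)%N by clear; lia.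
have se : (s <= s + l + r + l)%N by clear; lia.
have slN : (s + l <= N)%N by clear - sN; lia.
have tau0 : \tr (E ^+ N) != 0 by rewrite -cabs_gt0; lra.
have K_gt0 : 0 < K by lra.
have kr0 : 0 <= kap ^+ r by rewrite exprn_ge0 // cabs_ge0.
have hXY : window_op A s (s + l + r + l) (opmul X Y) (lam ^+ r *: P).
  have [a1 a2 a3] : [/\ s <= s + l, s + l <= s + l + r & s + l + r <= s + l + r + l]%N.
    by rewrite !leq_addr.
  have := window_op_mul a1 a2 a3 hX hY.
  by rewrite addKn -[_ * _ * _]/(_ *m _ *m _) transfer_XY.
set tau := \tr _ in tau2 tau2' tau0.
set x := ev psi X in fXY; set y := ev psi Y in fXY.
have y_le : cabs y <= K by have := schur_bounded_ev psi bY; rewrite -/(nsq psi) psi1 mulr1.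
pose q := lam ^+ r / tau.
have q_ge : kap ^+ r / 2 <= cabs q.
  by rewrite /q cabsM cabsV cabsX ler_wpM2l // lef_pV2 ?posrE //; lra.
have K4 : kap ^+ r / (4 * K) <= kap ^+ r / 4.
  by rewrite ler_wpM2l // lef_pV2 ?posrE //; lra.
(* If [|x y|] is at most half of [|q|], then [X Y] separates the states. Otherwise [|y| <= K] makes
   [|x|] large, while [X] has mean 0 in the matrix product state. *)
have [xy|xy] := lerP (cabs (x * y)) (cabs q / 2).
  (* The phase makes the difference real and nonnegative, so that several blocks cannot cancel. *)
  have [c c1 cE] := phase_ex (q - x * y).
  exists (opscale c (opmul X Y)), (s + l + r + l)%N, ((c * lam ^+ r) *: P); split.
  - split; first by rewrite -scalerA; apply: window_op_scale.
    by right; exists (c * lam ^+ r) => //; rewrite cabsM c1 mul1r cabsX.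
  - by rewrite se esE leqnn.
  - by apply: schur_bounded_scale c1 _; apply: schur_bounded_mul => //; exact: ltW.
  exists (cabs (q - x * y)).
    have := cabsD (q - x * y) (x * y); rewrite subrK; lra.
  rewrite !ev_opscale -mulrBr -cE; congr (_ * _); rewrite fXY ev_mps //; congr (_ - _).
  by rewrite (ev_P sd se _ hXY) // esE.
have [c c1 cE] := phase_ex (- x).
exists (opscale c X), (s + l)%N, (c *: (u *m w)); split.
- split; first exact: window_op_scale.
  by left; exists c.
- by rewrite leq_addr -addnA leq_add2l mul2n -addnn -addnA leq_addr.
- apply: schur_bounded_scale c1 _; apply: schur_bounded_le bX.
  by rewrite ler_peMl // ltW.
exists (cabs (- x)).
  rewrite cabsN ler_pdivrMr; last by lra.
  have := cabs_ge0 x; rewrite cabsM in xy => x0; nra.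
rewrite !ev_opscale -cE -mulrBr; congr (_ * _).
have Xe : window_op A s (s + l) X (1 *: (u *m w)) by rewrite scale1r.
by rewrite ev_mps // (ev_X sd (leq_addr _ _) slN Xe) mul0r sub0r.
Qed.

End Blocks.

(** * Assembly of many separating blocks *)

Theorem theorem1 (R : realType) (d D : nat) (A : 'I_d -> 'M[R[i]]_D) (xi : R)
  (hnormal : normal_tensor A) (hxi : corr_length A xi) (hxi0 : 0 < xi)
  (k : nat) (T : nat -> nat) (psi : forall N : nat, state R N d)
  (hpsi : forall N : nat, circuit_state k (T N) (psi N))
  (hT : little_o_log R T) :
  exists N0 : nat, forall N : nat, (N0 < N)%N ->
    1 - cabs (dot (mps A N) (psi N)) > 1 / 2.
Proof.
have [lam [u [z [v0 [w [K0 [rho sd]]]]]]] := spectral_data_exists hnormal hxi hxi0.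
have [D0 d0] := spectral_data_dim sd.
have [l [B hB]] := words_span hnormal.1 D0 (sd_u sd) (sd_v0 sd) (sd_v0u sd) (sd_rho0 sd)
  (sd_rho1 sd) (sd_decay sd).
have [X /window_op_exists[K1 K1_ge0 hX]] := transfer_surjective hB (u *m w).
have [Y /window_op_exists[K2 K2_ge0 hY]] := transfer_surjective hB (z *m v0).
pose K := K1 + K2 + 1.
have K_ge1 : 1 <= K by rewrite /K; lra.
have K_gt0 : 0 < K by lra.
(* [1200 = 3 * 4^2 * 5^2]: 4 from [delta], 5 from the bound [n delta / 5] on fluctuations, 3 for the
   error terms that share its square. *)
pose eps : R := (1200 * (K * K))^-1.
have eps0 : 0 < eps by rewrite invr_gt0 !mulr_gt0.
have eps1 : eps <= 1.
  rewrite invf_le1 ?mulr_gt0 //; nra.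
set kap := cabs lam.
have kap0 : 0 < kap := sd_lam0 sd; have kap1 : kap < 1 := sd_lam1 sd.
have [p0 hp0] := expr_small (2 * overlap_const u w) kap0 kap1 eps0.
have e40 : 0 < eps / 4 by lra.
have [Ntau htau] := expr_small ((D * D)%N%:R * K0) (sd_rho0 sd) (sd_rho1 sd) e40.
(* Makes [n] large enough for [K^4 <= n kap^(4 t) eps], which controls the diagonal of the
   variances. *)
have [Nblock hblock] := block_count (K * K * (K * K) / eps) k l p0 kap0 kap1 hT.
exists (maxn Ntau Nblock) => N; rewrite gtn_max => /andP[NtauN NblockN].
have [n [hn hncst]] := hblock N NblockN.
set t := (T N * k)%N in hn hncst.
have x0 : config N d := [ffun => Ordinal d0].
have [fpsi epsi] := circuit_factorizing x0 (hpsi N); rewrite -/t in fpsi.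
clearbody t.
have psi1 := nsq_unit epsi.
set ph := mps A N; set ps := psi N in fpsi epsi psi1 *.
have tau1 : cabs (\tr (transfer A ^+ N) - 1) < eps / 4.
  by apply: le_lt_trans (mxtrace_expE_cvg sd N) _; apply: htau; exact: ltnW.
have [tau2 tau2'] : 1 / 2 <= cabs (\tr (transfer A ^+ N)) /\ cabs (\tr (transfer A ^+ N)) <= 2.
  have := cabsD (\tr (transfer A ^+ N) - 1) 1; rewrite subrK cabs1.
  have := cabsB (\tr (transfer A ^+ N)) (\tr (transfer A ^+ N) - 1).
  rewrite opprB addrCA subrr addr0 cabs1; split; lra.
have tau0 : \tr (transfer A ^+ N) != 0 by rewrite -cabs_gt0; lra.
have ephi : ev ph (@opid R N d) = 1.
  by rewrite ev_mps // (ev_mps_raw_id A) divff.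
(* Within a block [X] and [Y] are [r = 2 t] sites apart, twice the light-cone radius [t]; [h] leaves
   another [2 t] sites before the next block. *)
pose h := (2 * l + 4 * t)%N; pose r := (2 * t)%N.
(* The offset makes correlations around the ring at most [kap ^+ (4 * t) * eps] and keeps the light
   cones off the left end. *)
pose s (j : 'I_n) := (4 * t + p0 + j * h)%N.
have s_sep (j j' : 'I_n) : (j < j')%N -> (s j + h <= s j')%N.
  by move=> jj'; rewrite /s -addnA leq_add2l -mulSnr leq_mul2r jj' orbT.
have s_end (j : 'I_n) : (s j + h <= N)%N.
  by apply: leq_trans hn; rewrite /s -addnA leq_add2l -mulSnr leq_mul2r ltn_ord orbT.
have s_ge (j : 'I_n) : (4 * t + p0 <= s j)%N by rewrite leq_addr.
have /boolp.choice[O hO] (j : 'I_n) : exists Oj : op R N d, exists e M,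
  [/\ block_op A lam u v0 w r (s j) e Oj M, (s j <= e <= s j + 2 * l + r)%N,
      schur_bounded (K * K) Oj &
   exists2 g, kap ^+ r / (4 * K) <= g & ev ph Oj - ev ps Oj = g%:C%C].
  have [Xj wX bX] := hX N (s j); have [Yj wY bY] := hY N (s j + l + r)%N.
  apply: (distinguishing_block sd K_ge1 _ tau2 tau2' wX wY) => //.
  - by move: (s_end j); rewrite /h /r; move: (s j) => sj; clear; lia.
  - by apply: schur_bounded_le bX; rewrite /K; lra.
  - by apply: schur_bounded_le bY; rewrite /K; lra.
  apply: (fpsi _ _ _ _ _ _ _ _ _ _ _ (window_op_local wX) (window_op_local wY));
    move: (s_end j) (s_ge j); rewrite /h /r; move: (s j) => sj; clear; lia.
have bO j : schur_bounded (K * K) (O j) by have [e [M []]] := hO j.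
have KK0 : 0 <= K * K by rewrite mulr_ge0 // ltW.
pose eta := 2 * overlap_const u w * kap ^+ (4 * t + p0) +
  4 * kap ^+ (2 * r) * cabs (\tr (transfer A ^+ N) - 1).
have eta0 : 0 <= eta.
  by rewrite addr_ge0 // !mulr_ge0 ?exprn_ge0 ?cabs_ge0.
have corr_lt (j j' : 'I_n) : (j < j')%N ->
    cabs (ev ph (opmul (opadj (O j)) (O j')) - conjc (ev ph (O j)) * ev ph (O j')) <= eta.
  move=> jj'; have [e [M [hj /andP[se es] _ _]]] := hO j.
  have [e' [M' [hj' /andP[se' es'] _ _]]] := hO j'.
  apply: (block_corr sd _ _ _ _ (s_ge j) tau2 hj hj') => //;
    move: es es' (s_end j') (s_sep _ _ jj'); rewrite /h /r;
    move: (s j) (s j') => sj sj'; clear; lia.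
(* Commutation is recorded as well, to treat pairs of blocks in the opposite order. *)
have psi_lt (j j' : 'I_n) : (j < j')%N -> forall O1 O2 : op R N d,
    (O1 = O j \/ O1 = opadj (O j)) -> (O2 = O j' \/ O2 = opadj (O j')) ->
  ev ps (opmul O1 O2) = ev ps O1 * ev ps O2 /\ opmul O1 O2 = opmul O2 O1.
  move=> jj' O1 O2 h1 h2.
  have [e [M [[hj _] /andP[se es] _ _]]] := hO j.
  have [e' [M' [[hj' _] /andP[se' es'] _ _]]] := hO j'.
  have l1 : local_op (sites N (s j) e) O1.
    by have lj := window_op_local hj; case: h1 => ->; last apply: local_op_adj.
  have l2 : local_op (sites N (s j') e') O2.
    by have lj := window_op_local hj'; case: h2 => ->; last apply: local_op_adj.
  split.
    apply: (fpsi _ _ _ _ _ _ _ _ _ _ _ l1 l2);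
      move: se es se' es' (s_end j') (s_sep _ _ jj') (s_ge j); rewrite /h /r;
      move: (s j) (s j') => sj sj'; clear; lia.
  apply: local_op_comm l1 l2; apply/pred0Pn => -[i /=]; rewrite !inE.
  move: es (s_sep _ _ jj'); rewrite /h /r; move: (s j) (s j') (val i) => sj sj' i'; clear; lia.
pose delta := kap ^+ r / (4 * K).
have kr0 : 0 < kap ^+ r by rewrite exprn_gt0.
have delta0 : 0 < delta by rewrite divr_gt0 // mulr_gt0.
have n0 : (0 : R) < n%:R.
  rewrite ltr0n lt0n; apply/negP => /eqP n0; move: hncst.
  by rewrite n0 mul0r ltNge divr_ge0 ?mulr_ge0 // ltW.
(* With [B = n delta / 5] the overlap is at most [2/5], below [1/2]. *)
have := @overlap_bound R N d n O ph ps (K * K * (K * K)) eta delta (n%:R * delta / 5)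
  ephi epsi eta0 _ _ _ _ _ _ _.
have -> : 2 * (n%:R * delta / 5) = n%:R * delta * (2 / 5) :> R by ring.
rewrite ler_pM2l ?(mulr_gt0 n0 delta0) // => ov.
suff : cabs (dot ph ps) <= 2 / 5 by lra.
apply: ov.
- by rewrite divr_ge0 // mulr_ge0 // ltW.
- move=> j; have := schur_bounded_ev ph (schur_bounded_mul KK0 KK0 (schur_bounded_adj (bO j)) (bO j)).
  by rewrite -/(nsq ph) (nsq_unit ephi) mulr1.
- move=> j; have := schur_bounded_ev ps (schur_bounded_mul KK0 KK0 (bO j) (schur_bounded_adj (bO j))).
  by rewrite -/(nsq ps) psi1 mulr1.
- move=> j j'; rewrite neq_ltn => /orP[jj'|jj']; first exact: corr_lt.
  have -> : ev ph (opmul (opadj (O j)) (O j')) = conjc (ev ph (opmul (opadj (O j')) (O j))).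
    by rewrite -ev_adj opadj_mul opadjK.
  by have := corr_lt _ _ jj'; rewrite -cabsJ rmorphB rmorphM /= conjcK [ev ph (O j') * _]mulrC.
- move=> j j'; rewrite neq_ltn => /orP[jj'|jj'].
    by have [] := psi_lt _ _ jj' (O j) (opadj (O j')) (or_introl erefl) (or_intror erefl).
  have [h1 h2] := psi_lt _ _ jj' (opadj (O j')) (O j) (or_intror erefl) (or_introl erefl).
  by rewrite -h2 h1 mulrC.
- by move=> j; have [e [M [_ _ _ hg]]] := hO j.
set a := kap ^+ (4 * t).
have a0 : 0 < a by rewrite exprn_gt0.
have aE : kap ^+ (2 * r) = a by rewrite /r mulnA.
have deltaE : (n%:R * delta / 5) ^+ 2 = 3 * (n%:R ^+ 2 * a * eps).
  have -> : a = kap ^+ r * kap ^+ r by rewrite -exprD /a /r; congr (_ ^+ _); clear; lia.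
  by rewrite /delta /eps; field; rewrite gt_eqF.
have K4 : K * K * (K * K) <= n%:R * a * eps.
  by rewrite -ler_pdivrMr // ltW.
(* One [a * eps] comes from the choice of [p0], the other from that of [Ntau]. *)
have eta_le : eta <= 2 * (a * eps).
  rewrite /eta aE exprD -/a.
  have h1 : a * (2 * overlap_const u w * kap ^+ p0) <= a * eps.
    by rewrite ler_wpM2l ?(ltW a0) // ltW // hp0.
  have h2 : a * (4 * cabs (\tr (transfer A ^+ N) - 1)) <= a * eps.
    by rewrite ler_wpM2l ?(ltW a0) //; lra.
  lra.
have h1 : n%:R * (K * K * (K * K)) <= n%:R * (n%:R * a * eps) by rewrite ler_wpM2l // ltW.
have h2 : n%:R ^+ 2 * eta <= n%:R ^+ 2 * (2 * (a * eps)) by rewrite ler_wpM2l // sqr_ge0.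
rewrite deltaE; lra.
Qed.
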